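(* Let $G$ and $H$ be finite simple graphs. Then for every $k\ge 0$ the cohomology of the product graph $G\times H$ satisfies $$H^k(G\times H)\;\cong\;\bigoplus_{i+j=k} H^i(G)\otimes H^j(H).$$
   Context: Product: for finite simple graphs $G,H$, the graph $G\times H$ has as vertices all pairs $(x,y)$ with $x$ a nonempty complete subgraph (simplex, identified with its vertex set) of $G$ and $y$ a nonempty complete subgraph of $H$. Two distinct vertices $(x,y)\neq(x',y')$ are adjacent iff ($x\subseteq x'$ and $y\subseteq y'$) or ($x'\subseteq x$ and $y'\subseteq y$). Graph cohomology: for a finite simple graph $G$, let the $k$-simplices be the complete subgraphs $K_{k+1}$ of $G$ (Whitney/clique complex), each with a fixed orientation. $\Omega^k(G)$ is the finite-dimensional real vector space of functions on $k$-simplices, extended antisymmetrically to orderings of their vertices, with exterior derivative $d_k:\Omega^k(G)\to\Omega^{k+1}(G)$, $d_kf(x_0,\dots,x_{k+1})=\sum_l(-1)^l f(x_0,\dots,\hat{x}_l,\dots,x_{k+1})$. $H^k(G)=\ker d_k/\operatorname{im} d_{k-1}$. All tensor products are over $\mathbb{R}$. *)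

(* Defs.v *)
From HB Require Import structures.
From mathcomp Require Import all_boot all_order all_fingroup all_algebra.
From mathcomp Require Import generic_quotient ring_quotient.
From mathcomp Require Import reals zify.

Set Implicit Arguments.
Unset Strict Implicit.
Unset Printing Implicit Defensive.

Import GRing.Theory.
Local Open Scope ring_scope.

Record sgraph := SGraph {
  vertex :> finType;
  adj : rel vertex;
  adj_sym : symmetric adj;
  adj_irr : irreflexive adj
}.

Section Graphs.
Implicit Types G H : sgraph.

Definition clique G (S : {set G}) : bool :=
  [forall x in S, forall y in S, (x != y) ==> adj x y].

Definition simplex G (S : {set G}) : bool := (S != set0) && clique S.

Lemma cliqueS G (S S' : {set G}) : S \subset S' -> clique S' -> clique S.
Proof.
move=> /subsetP sS /forall_inP cS'.
apply/forall_inP => x /sS /cS' /forall_inP h.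
by apply/forall_inP => y /sS /h.
Qed.

Definition prod_vertex G H : finType :=
  {p : {set G} * {set H} | simplex p.1 && simplex p.2}.

Definition prod_adj G H : rel (prod_vertex G H) := fun p q =>
  (p != q) &&
  (((val p).1 \subset (val q).1) && ((val p).2 \subset (val q).2) ||
   ((val q).1 \subset (val p).1) && ((val q).2 \subset (val p).2)).

Lemma prod_adj_sym G H : symmetric (@prod_adj G H).
Proof. by move=> p q; rewrite /prod_adj eq_sym orbC. Qed.

Lemma prod_adj_irr G H : irreflexive (@prod_adj G H).
Proof. by move=> p; rewrite /prod_adj eqxx. Qed.

Definition gprod G H : sgraph :=
  SGraph (@prod_adj_sym G H) (@prod_adj_irr G H).

(* A k-simplex together with an ordering x_0, ..., x_k of its vertices. *)
Definition is_osimplex G k (x : {ffun 'I_k.+1 -> G}) : bool :=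
  injectiveb x && clique [set x i | i : 'I_k.+1].

Definition osimplex G k : finType := {x : {ffun 'I_k.+1 -> G} | is_osimplex x}.

Lemma osimplex_comp G m n (x : osimplex G m) (h : 'I_n.+1 -> 'I_m.+1) :
  injective h -> is_osimplex [ffun i => val x (h i)].
Proof.
move=> h_inj; case/andP: (valP x) => /injectiveP x_inj x_cl.
apply/andP; split.
  by apply/injectiveP => i j; rewrite !ffunE => /x_inj /h_inj.
apply: cliqueS x_cl; apply/subsetP => _ /imsetP[i _ ->].
by rewrite ffunE; apply/imsetP; exists (h i).
Qed.

Definition face G k (l : 'I_k.+2) (x : osimplex G k.+1) : osimplex G k :=
  exist _ [ffun i => val x (lift l i)] (osimplex_comp x (@lift_inj _ l)).

Definition reorder G k (s : 'S_k.+1) (x : osimplex G k) : osimplex G k :=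
  exist _ [ffun i => val x (s i)] (osimplex_comp x (@perm_inj _ s)).

End Graphs.

Section QuotientSpace.
Variables (K : fieldType) (V : vectType K) (W : {vspace V}).
Local Open Scope quotient_scope.

Definition quotv : Type := Quotient.quot (pred_of_vspace W : zmodClosed V).

HB.instance Definition _ := GRing.Zmodule.on quotv.

Definition piv (v : V) : quotv :=
  \pi_(Quotient.quot (pred_of_vspace W : zmodClosed V)) v.

Definition reprv (q : quotv) : V :=
  repr (q : Quotient.quot (pred_of_vspace W : zmodClosed V)).

Lemma reprvK : cancel reprv piv.
Proof. by move=> q; rewrite /piv /reprv reprK. Qed.

Lemma piv_eq (v w : V) : (piv v == piv w) = (v - w \in W).
Proof. by rewrite (Quotient.idealrBE (pred_of_vspace W : zmodClosed V)). Qed.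

Lemma piv_surj (q : quotv) : exists v, q = piv v.
Proof. by exists (reprv q); rewrite reprvK. Qed.

Lemma pivD : {morph piv : v w / v + w}.
Proof. exact: Quotient.pi_add. Qed.

Definition scalev (a : K) (q : quotv) : quotv := piv (a *: reprv q).

Lemma scalevE a v : scalev a (piv v) = piv (a *: v).
Proof.
by apply/eqP; rewrite piv_eq -scalerBr memvZ // -piv_eq reprvK.
Qed.

Fact scalevA a b q : scalev a (scalev b q) = scalev (a * b) q.
Proof. by have [v ->] := piv_surj q; rewrite !scalevE scalerA. Qed.

Fact scale1v : left_id 1 scalev.
Proof. by move=> q; have [v ->] := piv_surj q; rewrite scalevE scale1r. Qed.

Fact scalevDr : right_distributive scalev +%R.
Proof.
move=> a q r; have [v ->] := piv_surj q; have [w ->] := piv_surj r.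
by rewrite -pivD !scalevE -pivD scalerDr.
Qed.

Fact scalevDl q : {morph scalev^~ q : a b / a + b}.
Proof.
by move=> a b; have [v ->] := piv_surj q; rewrite !scalevE -pivD scalerDl.
Qed.

HB.instance Definition _ :=
  GRing.Zmodule_isLmodule.Build K quotv scalevA scale1v scalevDr scalevDl.

Fact piv_is_linear : linear piv.
Proof. by move=> a v w; rewrite pivD -scalevE. Qed.

HB.instance Definition _ := GRing.isSemilinear.Build K V quotv _ piv
  (GRing.semilinear_linear piv_is_linear).

Let Wc := (W^C)%VS.
Let p := daddv_pi Wc W.

Let WcW0 : (Wc :&: W = 0)%VS. Proof. by rewrite capvC capv_compl. Qed.

Let p_eq (v w : V) : (p v == p w) = (v - w \in W).
Proof.
have WcWT u : u \in (Wc + W)%VS by rewrite addvC addv_complf memvf.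
rewrite -subr_eq0 -linearB /=; apply/eqP/idP => [p0|uW].
  by rewrite -(daddv_pi_add WcW0 (WcWT (v - w))) -/p p0 add0r memv_pi.
apply: (addIr (daddv_pi W Wc (v - w))).
rewrite /p (daddv_pi_add WcW0 (WcWT _)) add0r daddv_pi_id //.
by rewrite capvC.
Qed.

Fact quotv_vect_iso : Vector.axiom (\dim Wc) quotv.
Proof.
exists (fun q => \row_i coord (vbasis Wc) i (p (reprv q))).
  move=> a q r; apply/rowP => i; rewrite !mxE -linearP -linearP.
  congr (coord _ _ _); apply/eqP; rewrite p_eq -piv_eq.
  by rewrite linearP /= !reprvK.
exists (fun x : 'rV_(\dim Wc) => piv (\sum_i x 0 i *: (vbasis Wc)`_i)).
  move=> q; rewrite -[RHS]reprvK; apply/eqP; rewrite piv_eq -p_eq; apply/eqP.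
  have pW : p (reprv q) \in Wc by apply: memv_pi.
  rewrite -[RHS](daddv_pi_id WcW0 pW) {2}(coord_vbasis pW); congr (p _).
  by apply: eq_bigr => i _; rewrite mxE.
move=> x; apply/rowP => i; rewrite mxE.
set v := \sum_i _; have vW : v \in Wc.
  by apply: rpred_sum => j _; rewrite rpredZ ?vbasis_mem ?memt_nth.
have -> : p (reprv (piv v)) = v.
  rewrite -[RHS](daddv_pi_id WcW0 vW); apply/eqP.
  by rewrite p_eq -piv_eq reprvK.
by rewrite coord_sum_free ?(basis_free (vbasisP _)).
Qed.

HB.instance Definition _ := Lmodule_hasFinDim.Build K quotv quotv_vect_iso.

End QuotientSpace.

(* The space U / (U :&: W) of cosets in U; it is U / W when W <= U. *)
Definition subquotv (K : fieldType) (V : vectType K) (U W : {vspace V}) :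
    vectType K :=
  quotv (linfun (vsval : subvs_of U -> V) @^-1: W)%VS.

Section Tensor.
Variables (K : fieldType) (A B : vectType K).

(* The tensor product in coordinates: the matrix with a single 1 at (i, j) is
   the tensor of the basis vectors i of A and j of B. It satisfies the universal
   property tensor_univ. *)
Definition tensor : vectType K := 'M[K]_(\dim {:A}, \dim {:B}).

Definition tens (a : A) (b : B) : tensor :=
  \matrix_(i, j) (coord (vbasis {:A}) i a * coord (vbasis {:B}) j b).

Lemma tens_linearl b : linear (tens^~ b).
Proof.
by move=> c a a'; apply/matrixP => i j; rewrite !mxE linearP mulrDl mulrA.
Qed.

Lemma tens_linearr a : linear (tens a).
Proof.
move=> c b b'; apply/matrixP => i j.
by rewrite !mxE linearP mulrDr mulrCA.
Qed.

Let coord_basis (C : vectType K) (i j : 'I_(\dim {:C})) :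
  coord (vbasis {:C}) i (vbasis {:C})`_j = (i == j)%:R.
Proof. by rewrite coord_free ?(basis_free (vbasisP _)) // eq_sym. Qed.

Lemma tensor_univ (W : lmodType K) (beta : A -> B -> W) :
    (forall b, linear (beta^~ b)) -> (forall a, linear (beta a)) ->
  exists2 g : {linear tensor -> W}, forall a b, g (tens a b) = beta a b &
    forall g' : {linear tensor -> W},
      (forall a b, g' (tens a b) = beta a b) -> g' =1 g.
Proof.
move=> bl br.
pose g (M : tensor) := \sum_i \sum_j
  (M : 'M_(_, _)) i j *: beta (vbasis {:A})`_i (vbasis {:B})`_j.
have g_lin : linear g.
  move=> c M N; rewrite /g scaler_sumr -big_split; apply: eq_bigr => i _ /=.
  rewrite scaler_sumr -big_split; apply: eq_bigr => j _ /=.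
  by rewrite !mxE scalerA -scalerDl.
pose gL : {linear tensor -> W} :=
  HB.pack g (GRing.isSemilinear.Build _ _ _ _ g
    (GRing.semilinear_linear g_lin)).
have tens_basis (i : 'I_(\dim {:A})) (j : 'I_(\dim {:B})) :
    tens (vbasis {:A})`_i (vbasis {:B})`_j = delta_mx i j :> 'M_(_, _).
  apply/matrixP => k l; rewrite !mxE !coord_basis -natrM mulnb.
  by [].
exists gL => [a b|g' g'E M].
  pose bl' b' : {linear A -> W} := HB.pack (beta^~ b')
    (GRing.isSemilinear.Build _ _ _ _ (beta^~ b')
      (GRing.semilinear_linear (bl b'))).
  pose br' a' : {linear B -> W} := HB.pack (beta a')
    (GRing.isSemilinear.Build _ _ _ _ (beta a')
      (GRing.semilinear_linear (br a'))).
  rewrite /= /g [in RHS](coord_vbasis (memvf a)).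
  rewrite -[RHS]/(bl' b _) linear_sum; apply: eq_bigr => i _.
  rewrite linearZ /= [in RHS](coord_vbasis (memvf b)).
  rewrite -[beta _ _ in RHS]/(br' _ _) linear_sum scaler_sumr.
  by apply: eq_bigr => j _; rewrite linearZ /= mxE scalerA.
rewrite [in LHS](matrix_sum_delta (M : 'M_(_, _))) linear_sum /= /g.
apply: eq_bigr => i _; rewrite linear_sum; apply: eq_bigr => j _.
by rewrite linearZ /= -tens_basis g'E.
Qed.

End Tensor.

Section DirectSum.
Variables (K : fieldType) (n : nat) (T : 'I_n -> vectType K).

(* The external direct sum of T 0, ..., T n.-1; the index set is finite, so all
   families are allowed. *)
Definition dsum : Type := {dffun forall i, T i}.

HB.instance Definition _ := Choice.on dsum.
Implicit Types u v w : dsum.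

Definition dsum0 : dsum := [ffun i => 0 : T i].
Definition dsumN u : dsum := [ffun i => - u i].
Definition dsumD u v : dsum := [ffun i => u i + v i].
Definition dsumZ (a : K) u : dsum := [ffun i => a *: u i].

Fact dsumDA : associative dsumD.
Proof. by move=> u v w; apply/ffunP => i; rewrite !ffunE addrA. Qed.
Fact dsumDC : commutative dsumD.
Proof. by move=> u v; apply/ffunP => i; rewrite !ffunE addrC. Qed.
Fact dsum0D : left_id dsum0 dsumD.
Proof. by move=> u; apply/ffunP => i; rewrite !ffunE add0r. Qed.
Fact dsumND : left_inverse dsum0 dsumN dsumD.
Proof. by move=> u; apply/ffunP => i; rewrite !ffunE addNr. Qed.

HB.instance Definition _ :=
  GRing.isZmodule.Build dsum dsumDA dsumDC dsum0D dsumND.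

Fact dsumZA a b u : dsumZ a (dsumZ b u) = dsumZ (a * b) u.
Proof. by apply/ffunP => i; rewrite !ffunE scalerA. Qed.
Fact dsum1Z : left_id 1 dsumZ.
Proof. by move=> u; apply/ffunP => i; rewrite !ffunE scale1r. Qed.
Fact dsumZDr : right_distributive dsumZ +%R.
Proof. by move=> a u v; apply/ffunP => i; rewrite !ffunE scalerDr. Qed.
Fact dsumZDl u : {morph dsumZ^~ u : a b / a + b}.
Proof. by move=> a b; apply/ffunP => i; rewrite !ffunE scalerDl. Qed.

HB.instance Definition _ :=
  GRing.Zmodule_isLmodule.Build K dsum dsumZA dsum1Z dsumZDr dsumZDl.

Fact dsum_vect_iso : Vector.axiom (\sum_i \dim {:T i})%N dsum.
Proof.
exists (fun u => \mxrow_i \row_j coord (vbasis {:T i}) j (u i)).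
  move=> a u v; apply/mxrowP => i; rewrite mxrowK.
  rewrite [RHS](_ : _ = a *: submxrow (\mxrow_i \row_j
      coord (vbasis {:T i}) j (u i)) i + submxrow (\mxrow_i \row_j
      coord (vbasis {:T i}) j (v i)) i); last first.
    by apply/rowP => j; rewrite !mxE.
  rewrite !mxrowK; apply/rowP => j; rewrite !mxE -linearP; congr (coord _ _ _).
  by rewrite !ffunE.
exists (fun x : 'rV_(\sum_i \dim {:T i}) => [ffun i =>
    \sum_j (submxrow x i) 0 j *: (vbasis {:T i})`_j] : dsum).
  move=> u; apply/ffunP => i; rewrite ffunE mxrowK.
  rewrite [RHS](coord_vbasis (memvf _)).
  by apply: eq_bigr => j _; rewrite mxE.
move=> x; apply/mxrowP => i; rewrite mxrowK; apply/rowP => j.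
by rewrite mxE ffunE coord_sum_free ?(basis_free (vbasisP _)).
Qed.

HB.instance Definition _ := Lmodule_hasFinDim.Build K dsum dsum_vect_iso.

End DirectSum.

Section Cohomology.
Variables (K : fieldType) (G : sgraph).

(* All functions on ordered k-simplices; the forms are the antisymmetric ones. *)
Definition cochain k : vectType K := {ffun osimplex G k -> K^o}.

Definition antisym_defect k (f : cochain k) :
    {ffun 'S_k.+1 * osimplex G k -> K^o} :=
  [ffun p => f (reorder p.1 p.2) - (-1) ^+ p.1 * f p.2].

Fact antisym_defect_linear k : linear (@antisym_defect k).
Proof.
move=> a f g; apply/ffunP => p; rewrite !ffunE /= mulrDr opprD addrACA.
by rewrite scalerBr /GRing.scale /= [in RHS]mulrCA.
Qed.

HB.instance Definition _ k := GRing.isSemilinear.Build K (cochain k) _ _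
  (@antisym_defect k) (GRing.semilinear_linear (@antisym_defect_linear k)).

Definition forms k : {vspace cochain k} := lker (linfun (@antisym_defect k)).

Lemma formsP k (f : cochain k) :
  reflect (forall s x, f (reorder s x) = (-1) ^+ s * f x) (f \in forms k).
Proof.
rewrite memv_ker lfunE; apply: (iffP eqP) => [/ffunP f0 s x|f0].
  by have := f0 (s, x); rewrite !ffunE /= => /eqP; rewrite subr_eq0 => /eqP.
by apply/ffunP => -[s x]; rewrite !ffunE /= f0 subrr.
Qed.

Definition Omega k : vectType K := subvs_of (forms k).

Definition cobound k (f : cochain k) : cochain k.+1 :=
  [ffun x => \sum_(l < k.+2) (-1) ^+ l * f (face l x)].

Fact cobound_linear k : linear (@cobound k).
Proof.
move=> a f g; apply/ffunP => x; rewrite !ffunE scaler_sumr -big_split /=.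
by apply: eq_bigr => l _; rewrite !ffunE mulrDr /GRing.scale /= mulrCA.
Qed.

Lemma face_reorder k (s : 'S_k.+2) l (x : osimplex G k.+1) :
  exists2 t : 'S_k.+1, face l (reorder s x) = reorder t (face (s l) x) &
    odd_perm s = odd l (+) odd (s l) (+) odd_perm t.
Proof.
have ulK i : {j | s (lift l i) = lift (s l) j}.
  case: (unliftP (s l) (s (lift l i))) => [j ->|/perm_inj/eqP]; first by exists j.
  by rewrite eq_sym (negPf (neq_lift _ _)).
have [t tP] : {t | forall i, s (lift l i) = lift (s l) (t i)}.
  by exists (fun i => sval (ulK i)) => i; exact: svalP (ulK i).
have t_inj : injective t.
  move=> i j eij; apply: (@lift_inj _ l); apply: (@perm_inj _ s).
  by rewrite !tP eij.
have sE : s = lift_perm l (s l) (perm t_inj).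
  apply/permP => i; case: (unliftP l i) => [j ->|->].
    by rewrite lift_perm_lift permE tP.
  by rewrite lift_perm_id.
exists (perm t_inj); last by rewrite [in LHS]sE odd_lift_perm.
by apply/val_inj/ffunP => i; rewrite /= !ffunE permE tP.
Qed.

Lemma cobound_forms k (f : cochain k) : f \in forms k -> cobound f \in forms k.+1.
Proof.
move=> /formsP fA; apply/formsP => s x; rewrite !ffunE mulr_sumr.
rewrite [RHS](reindex_inj (@perm_inj _ s)); apply: eq_bigr => l _ /=.
have [t -> ->] := face_reorder s l x; rewrite fA.
rewrite !mulrA; congr (_ * _).
rewrite -[(-1) ^+ l]signr_odd -[(-1) ^+ s l]signr_odd -!signr_addb.
by congr (_ ^+ nat_of_bool _); case: (odd l); case: (odd (s l)); case: (odd_perm t).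
Qed.

Definition d_fun k (w : Omega k) : Omega k.+1 :=
  Subvs (cobound_forms (subvsP w)).

Fact d_fun_linear k : linear (@d_fun k).
Proof. by move=> a w v; apply: val_inj; rewrite /= cobound_linear. Qed.

HB.instance Definition _ k := GRing.isSemilinear.Build K (Omega k) _ _
  (@d_fun k) (GRing.semilinear_linear (@d_fun_linear k)).

Definition dext k : 'Hom(Omega k, Omega k.+1) := linfun (@d_fun k).

Definition boundaries k : {vspace Omega k} :=
  if k is k'.+1 then limg (dext k') else 0%VS.

Definition cohomology k : vectType K := subquotv (lker (dext k)) (boundaries k).

Lemma dext_dext k (w : Omega k) : dext k.+1 (dext k w) = 0.
Proof.
rewrite /dext !lfunE; apply: val_inj; apply/ffunP => x; rewrite !ffunE.
set f := vsval w.
under eq_bigr do rewrite !ffunE mulr_sumr.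
rewrite pair_bigA /= (bigID (fun p : 'I_k.+3 * 'I_k.+2 => (p.2 < p.1)%N)) /=.
apply/eqP; rewrite addr_eq0 -sumrN; apply/eqP.
pose h (p : 'I_k.+3 * 'I_k.+2) : 'I_k.+3 * 'I_k.+2 :=
  (inord p.2, inord p.1.-1).
pose h' (p : 'I_k.+3 * 'I_k.+2) : 'I_k.+3 * 'I_k.+2 :=
  (inord p.2.+1, inord p.1).
rewrite [LHS](reindex_onto h' h) /=; last first.
  move=> [i j] /= ji; have i0 : (0 < i)%N by apply: leq_ltn_trans ji.
  have ik : (i.-1 < k.+2)%N by rewrite -ltnS prednK.
  rewrite /h' /h /= (inordK ik) prednK // inord_val inordK ?inord_val //.
  exact: ltn_trans (ltn_ord j) _.
have le_lt (i : 'I_k.+3) (j : 'I_k.+2) : (i <= j)%N -> (i < k.+2)%N.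
  by move=> ij; apply: leq_ltn_trans ij (ltn_ord j).
have j1 (j : 'I_k.+2) : (j.+1 < k.+3)%N by rewrite ltnS.
apply: eq_big => [[i j]|[i j]]; rewrite /h' /h /= (inordK (j1 j)).
  rewrite -leqNgt inord_val; case: (leqP i j) => [ij|ji].
    by rewrite (inordK (le_lt _ _ ij)) ltnS ij inord_val eqxx.
  apply/negbTE/negP => /andP[ij /eqP/(congr1 (fun p => val p.1)) /= e].
  have ik : (i < k.+2)%N.
    by rewrite -e inordK ?(ltn_ord (inord i)) // (ltn_trans (ltn_ord _)).
  by rewrite inordK // ltnS leqNgt ji in ij.
move=> /andP[ij /eqP/(congr1 (fun p => val p.1)) /= e].
have ik : (i < k.+2)%N.
  by rewrite -e inordK ?(ltn_ord (inord i)) // (ltn_trans (ltn_ord _)).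
rewrite inordK // ltnS in ij; rewrite inordK //.
have -> : face (inord i) (face (inord j.+1) x) = face j (face i x).
  apply: val_inj; apply/ffunP => m; rewrite /= !ffunE.
  congr (val x _); apply: val_inj; rewrite /= (inordK (j1 j)) (inordK ik).
  by rewrite /bump; lia.
by rewrite exprS mulN1r mulNr; congr (- _); rewrite mulrCA.
Qed.

End Cohomology.

(* Main.v *)
(* Both sides are finite-dimensional, so the statement is an equality of Betti
   numbers. Let a triple [((S, T), Z)] consist of vertex sets of [G], [H] and
   [gprod G H], where [Z] is a chain of pairs of simplices all of which contain
   [(S, T)] componentwise. The triples span a subquotient of the exterior algebra
   on the disjoint union of the three vertex sets. Each of the following families
   is acyclic, because of a matching that toggles one vertex:
   - [S, T <> 0], [Z] arbitrary: toggle the vertex [(S, T)] in [Z];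
   - [T, Z <> 0], [S] arbitrary: toggle in [S] a common vertex of the first
     components of [Z];
   - [S = 0], [Z <> 0], [T] arbitrary: toggle in [T] a common vertex of the second
     components of [Z].
   Splitting each family by whether the toggled set is empty, the three long exact
   sequences identify, up to a shift, the cohomology of the product cells ([Z = 0])
   with that of the clique complex of [gprod G H] ([S = T = 0]). The cells form the
   tensor product of the complexes of [G] and [H]; a contraction [h] of each complex
   onto a projection [r = 1 - dh - hd] with [dr = rd = 0] gives one for the tensor
   product, and the Betti numbers are the traces of [r]. *)
From HB Require Import structures.
Require Import Defs.
From mathcomp Require Import all_boot all_order all_algebra all_fingroup reals zify
  ring.

Set Implicit Arguments.
Unset Strict Implicit.
Unset Printing Implicit Defensive.

Import VectorInternalTheory Order.TTheory GRing.Theory Num.Theory.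
Local Open Scope ring_scope.

(** * Linear algebra *)

Section Dimension.
Variable K : fieldType.

(** The hypotheses make [f] induce an isomorphism from [Z / B] to [Z' / B']: exactly [B] goes to
    [B'], and [f @: Z] meets every class modulo [B']. The kernel of [f] on [Z] lies in [B], so it
    cancels in the difference. *)
Lemma dim_quasi_iso (E E' : vectType K) (Z B : {vspace E}) (Z' B' : {vspace E'})
    (f : 'Hom(E, E')) :
    (B <= Z)%VS -> (B' <= Z')%VS -> (f @: Z <= Z')%VS ->
    (forall z, z \in Z -> (f z \in B') = (z \in B)) ->
    (forall z', z' \in Z' -> exists2 z, z \in Z & z' - f z \in B') ->
  (\dim Z - \dim B = \dim Z' - \dim B')%N.
Proof.
move=> BZ BZ' fZ fB fs.
have Z'E : (Z' = f @: Z + B')%VS.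
  apply/eqP; rewrite eqEsubv subv_add fZ BZ' !andbT; apply/subvP => z' /fs[z zZ].
  move=> zB; rewrite -(subrKC (f z) z') memv_add ?memv_img //.
have kE : (Z :&: lker f = B :&: lker f)%VS.
  apply/vspaceP => z; rewrite !memv_cap memv_ker.
  have [fz0|] := eqVneq (f z) 0; rewrite ?andbF ?andbT //.
  have [/fB <-|] := boolP (z \in Z); first by rewrite fz0 mem0v.
  by move=> zZ; apply/esym/negbTE; apply: contra zZ; apply: subvP BZ z.
have cE : (f @: Z :&: B' = f @: B)%VS.
  apply/eqP; rewrite eqEsubv; apply/andP; split; apply/subvP => y.
    rewrite memv_cap => /andP[/memv_imgP[z zZ ->]].
    by rewrite fB // => /memv_img; apply.
  case/memv_imgP => b bB ->; have bZ := subvP BZ _ bB.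
  by rewrite memv_cap memv_img //= fB.
have := dimv_add_leqif (f @: Z) B'.
have := dimv_sum_cap (f @: Z) B'; rewrite -Z'E cE.
have := limg_ker_dim f Z; have := limg_ker_dim f B; rewrite -kE.
have := dimvS BZ; have := dimvS BZ'.
by lia.
Qed.

(** Rank-nullity for the projection onto the quotient. Its kernel, the preimage of [W], has the
    dimension of [W] because the inclusion of [U] is injective and [W <= U]. *)
Lemma dim_subquotv (V : vectType K) (U W : {vspace V}) :
  (W <= U)%VS -> \dim {:subquotv U W} = (\dim U - \dim W)%N.
Proof.
move=> WU; set f := linfun (vsval : subvs_of U -> V).
have fE x : f x = vsval x by rewrite lfunE.
have kf : lker f = 0%VS.
  apply/eqP; rewrite -subv0; apply/subvP => x; rewrite memv_ker fE memv0.
  by move/eqP => x0; apply/eqP/val_inj.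
have := limg_ker_dim (linfun (piv (f @^-1: W)%VS)) fullv.
have -> : lker (linfun (piv (f @^-1: W)%VS)) = (f @^-1: W)%VS.
  apply/vspaceP => x; rewrite memv_ker lfunE /=.
  have -> : (0 : quotv (f @^-1: W)) = piv _ 0 by rewrite linear0.
  by rewrite piv_eq subr0.
have -> : limg (linfun (piv (f @^-1: W)%VS)) = fullv.
  apply/vspaceP => q; rewrite memvf; have [v ->] := piv_surj q.
  by apply/memv_imgP; exists v; rewrite ?memvf // lfunE.
rewrite capfv => /eqP; rewrite dimvf /= /subquotv -/f => e.
have Wd : \dim (f @^-1: W)%VS = \dim W.
  rewrite -[LHS](@limg_dim_eq _ _ _ f); last by rewrite kf capv0.
  congr (\dim _); apply/vspaceP => w; apply/memv_imgP/idP => [[x + ->]|wW].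
    by rewrite memv_preim.
  have wU := subvP WU _ wW.
  by exists (Subvs wU); rewrite ?fE // -memv_preim fE.
move: e; rewrite Wd dimvf => /eqP e; rewrite -[\dim U]e.
by rewrite addKn.
Qed.

Lemma dim_linear_bij (A B : vectType K) :
  \dim {:A} = \dim {:B} -> exists phi : {linear A -> B}, bijective phi.
Proof.
rewrite !dimvf => e.
pose f (x : A) : B := r2v (castmx (erefl, e) (v2r x)).
have f_lin : linear f.
  move=> a x y; rewrite /f -linearP; congr r2v; apply/rowP => i.
  by rewrite linearP /= !(castmxE, mxE).
pose phi : {linear A -> B} := HB.pack f
  (GRing.isSemilinear.Build _ _ _ _ f (GRing.semilinear_linear f_lin)).
exists phi.
exists (fun y : B => r2v (castmx (erefl, esym e) (v2r y))) => x /=.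
  by rewrite /f r2vK castmx_comp castmx_id v2rK.
by rewrite /f r2vK castmx_comp castmx_id v2rK.
Qed.

Lemma dim_tensor (A B : vectType K) :
  \dim {:tensor A B} = (\dim {:A} * \dim {:B})%N.
Proof. by rewrite [LHS]dimvf; apply: dim_matrix. Qed.

Lemma dim_dsum n (T : 'I_n -> vectType K) :
  \dim {:dsum T} = (\sum_i \dim {:T i})%N.
Proof. by rewrite dimvf. Qed.

Lemma dim_cohomology (G : sgraph) k :
  \dim {:cohomology K G k} = (\dim (lker (dext K G k)) - \dim (boundaries K G k))%N.
Proof.
rewrite dim_subquotv //; case: k => [|k] /=; first exact: sub0v.
by apply/subvP => _ /memv_imgP[w _ ->]; rewrite memv_ker dext_dext.
Qed.

End Dimension.

(** * Cochain complexes given by an incidence kernel *)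

Section Kernels.
Variables (R : fieldType) (I : finType).
Implicit Types (c : I -> I -> R) (K P : pred I) (f g : {ffun I -> R^o}).

Lemma ffunZD a f g i : (a *: f + g) i = a * f i + g i.
Proof. by rewrite !ffunE. Qed.

Lemma ffunB f g i : (f - g) i = f i - g i.
Proof. by rewrite !ffunE. Qed.

Lemma ffunN f i : (- f) i = - f i.
Proof. by rewrite ffunE. Qed.

(** A whole complex lives in one function space: [c i j] is then the incidence number of the cell
    [i] with the cell [j], and degrees are recorded separately. *)
Definition kapp c f : {ffun I -> R^o} := [ffun i => \sum_j c i j * f j].

Fact kapp_linear c : linear (kapp c).
Proof.
move=> a f g; apply/ffunP => i; rewrite !ffunE scaler_sumr -big_split /=.
by apply: eq_bigr => j _; rewrite !ffunE mulrDr /GRing.scale /= mulrCA.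
Qed.

HB.instance Definition _ c := GRing.isSemilinear.Build R {ffun I -> R^o} _ _
  (kapp c) (GRing.semilinear_linear (kapp_linear c)).

Definition cut P f : {ffun I -> R^o} := [ffun i => if P i then f i else 0].

Lemma cutE P f i : cut P f i = if P i then f i else 0.
Proof. by rewrite [LHS]ffunE. Qed.

Fact cut_linear P : linear (cut P).
Proof.
move=> a f g; apply/ffunP => i; rewrite !ffunE.
by case: (P i) => //; rewrite scaler0 addr0.
Qed.

HB.instance Definition _ P := GRing.isSemilinear.Build R {ffun I -> R^o} _ _
  (cut P) (GRing.semilinear_linear (cut_linear P)).

Definition supp P : {vspace {ffun I -> R^o}} := lker (linfun (cut (predC P))).

Lemma suppP P f : reflect (forall i, f i != 0 -> P i) (f \in supp P).
Proof.
rewrite memv_ker lfunE; apply: (iffP eqP) => [/ffunP f0 i|fP].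
  by apply: contraNT => Pi; have := f0 i; rewrite !ffunE /= Pi => ->.
apply/ffunP => i; rewrite !ffunE /=; case: ifPn => // Pi.
by apply/eqP; apply: contraNT Pi => /fP.
Qed.

Lemma cut_supp P f : cut P f \in supp P.
Proof. by apply/suppP => i; rewrite ffunE; case: ifP; rewrite ?eqxx. Qed.

Lemma cut_id P f : f \in supp P -> cut P f = f.
Proof.
move/suppP => fP; apply/ffunP => i; rewrite ffunE; case: ifPn => // Pi.
by apply/esym/eqP; apply: contraNT Pi => /fP.
Qed.

Lemma supp0 P f i : f \in supp P -> ~~ P i -> f i = 0.
Proof. by move=> /suppP fP Pi; apply/eqP; apply: contraNT Pi => /fP. Qed.

(** Zeroing the entries outside [K], instead of shrinking the index type, lets all subquotients
    share one ambient space and one kernel. *)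
Definition restr K c i j := if K i && K j then c i j else 0.

End Kernels.

(** * Cocycles, coboundaries and Betti numbers of a family of cells *)

Section Betti.
Variables (R : fieldType) (I : finType) (deg : I -> nat) (c : I -> I -> R).
Implicit Types (K P : pred I) (f g : {ffun I -> R^o}).

Definition cochains K n : {vspace {ffun I -> R^o}} :=
  supp R [pred i | K i && (deg i == n)].
(* As [cochains K n.-1], but trivial when [n = 0]. *)
Definition precochains K n : {vspace {ffun I -> R^o}} :=
  supp R [pred i | K i && ((deg i).+1 == n)].
Definition cocycles K n : {vspace {ffun I -> R^o}} :=
  (cochains K n :&: lker (linfun (kapp (restr K c))))%VS.
Definition cobounds K n : {vspace {ffun I -> R^o}} :=
  (linfun (kapp (restr K c)) @: precochains K n)%VS.
Definition betti K n : nat := (\dim (cocycles K n) - \dim (cobounds K n))%N.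

Local Notation d K := (kapp (restr K c)).

Lemma kapp_restr_supp K f : d K f \in supp R K.
Proof.
apply/suppP => i; apply: contraNT => /negbTE Ki; rewrite ffunE big1 // => j _.
by rewrite /restr Ki mul0r.
Qed.

Lemma cocyclesP K n f :
  reflect ((forall i, f i != 0 -> K i && (deg i == n)) /\ d K f = 0)
    (f \in cocycles K n).
Proof.
rewrite memv_cap memv_ker lfunE /=.
by apply: (iffP andP) => [[/suppP fK /eqP]|[fK ->]] //; split=> //; exact/suppP.
Qed.

Lemma coboundsP K n f :
  reflect (exists2 g : {ffun I -> R^o}, forall i, g i != 0 ->
    K i && ((deg i).+1 == n) & f = d K g)
    (f \in cobounds K n).
Proof.
apply: (iffP memv_imgP) => [[g /suppP gK ->]|[g gK ->]]; exists g => //.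
- by rewrite lfunE.
- exact/suppP.
- by rewrite lfunE.
Qed.

Definition graded K := forall i j, K i -> K j -> c i j != 0 -> deg i = (deg j).+1.

Definition square_zero K := forall f, d K (d K f) = 0.

Definition exact K :=
  forall f, f \in supp R K -> d K f = 0 -> exists g, f = d K g.

Lemma kappE K f i : d K f i = if K i then \sum_(j | K j) c i j * f j else 0.
Proof.
rewrite ffunE /restr; case: (K i) => /=; last first.
  by rewrite big1 // => j _; rewrite mul0r.
rewrite [RHS]big_mkcond; apply: eq_bigr => j _.
by case: ifP => // _; rewrite mul0r.
Qed.

Lemma kapp_graded K f n : graded K ->
  (forall i, f i != 0 -> K i && ((deg i).+1 == n)) ->
  forall i, d K f i != 0 -> K i && (deg i == n).
Proof.
move=> gK fn i; rewrite kappE; case: ifP; rewrite ?eqxx // => Ki.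
apply: contraNT => /= din; rewrite big1 // => j Kj; apply/eqP.
rewrite mulf_eq0 -implyNb; apply/implyP => cij; apply: contraNT din.
by move=> /fn; rewrite Kj /= (gK i j Ki Kj cij).
Qed.

Lemma cobounds_cocycles K n : graded K -> square_zero K ->
  (cobounds K n <= cocycles K n)%VS.
Proof.
move=> gK sK; apply/subvP => _ /coboundsP[g gn ->]; apply/cocyclesP.
by split; [exact: kapp_graded | exact: sK].
Qed.

Lemma kapp_cut K f : d K (cut K f) = d K f.
Proof.
apply/ffunP => i; rewrite !kappE; case: ifP => // _.
by apply: eq_bigr => j Kj; rewrite ffunE Kj.
Qed.

(** Since the differential raises degrees by one, only the part of a primitive in the preceding
    degree contributes; the rest can be cut away. *)
Lemma exact_graded K n f : graded K -> exact K -> f \in cocycles K n ->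
  f \in cobounds K n.
Proof.
move=> gK eK /cocyclesP[fn df].
have [|g fg] := eK f _ df; first by apply/suppP => i /fn /andP[].
apply/coboundsP; exists (cut [pred i | K i && ((deg i).+1 == n)] g).
  by move=> i; rewrite ffunE; case: ifP; rewrite ?eqxx.
apply/ffunP => i; rewrite kappE.
case: (boolP (K i && (deg i == n))) => [/andP[Ki /eqP din]|].
  rewrite Ki fg kappE Ki; apply: eq_bigr => j Kj.
  have [-> |/(gK _ _ Ki Kj) dij] := eqVneq (c i j) 0; first by rewrite !mul0r.
  by rewrite ffunE /= Kj -dij din eqxx.
move=> Kin; rewrite [LHS](_ : _ = 0); last first.
  by apply/eqP; apply: contraNT Kin => /fn.
case: ifP => // Ki; rewrite big1 // => j Kj; apply/eqP.
rewrite mulf_eq0 -implyNb; apply/implyP => cij.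
by rewrite ffunE /= Kj -(gK _ _ Ki Kj cij); move: Kin; rewrite Ki /= => /negbTE->.
Qed.

(** * Acyclicity from a matching *)

Section Matching.
Variables (K t : pred I) (mu : I -> I) (w : I -> nat).
Hypothesis sK : square_zero K.
Hypothesis muK : forall a, K a -> mu (mu a) = a.
Hypothesis K_mu : forall a, K a -> K (mu a).
Hypothesis t_mu : forall a, K a -> t (mu a) = ~~ t a.
Hypothesis w_mu : forall a, K a -> w (mu a) = w a.
Hypothesis c_mu : forall a, K a -> t a -> c a (mu a) != 0.
Hypothesis c_lt : forall a b, K a -> K b -> t a -> ~~ t b -> c a b != 0 ->
  b != mu a -> (w b < w a)%N.

Let bot := [pred a | K a && ~~ t a].
(** The block of the differential from [bot] to its partners, read back on [bot] through [mu] and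
    completed by the identity. As an endomorphism it is invertible once it is injective. *)
Let T f : {ffun I -> R^o} :=
  [ffun a => if bot a then d K (cut bot f) (mu a) else f a].

Let TE f a : T f a = if bot a then d K (cut bot f) (mu a) else f a.
Proof. by rewrite [LHS]ffunE. Qed.

Let T_linear : linear T.
Proof.
move=> a f g; apply/ffunP => i; rewrite ffunZD !TE.
by case: ifP => _; rewrite ?ffunZD // !linearP /= ffunZD.
Qed.

Let TL : {linear {ffun I -> R^o} -> {ffun I -> R^o}} :=
  HB.pack T (GRing.isSemilinear.Build _ _ _ _ T (GRing.semilinear_linear T_linear)).

(* The matching makes the part of the differential from [~~ t] to [t]
   triangular for the weight. *)
Let T_inj f : T f = 0 -> f = 0.
Proof.
move=> /ffunP Tf; apply/ffunP => a; rewrite [RHS]ffunE.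
have [n] := ubnP (w a); elim: n a => // n IHn a wa.
have := Tf a; rewrite TE [RHS]ffunE; case: ifP => //; case/andP => Ka ta.
rewrite kappE K_mu // (bigD1 a) //= big1 => [|b ba]; last first.
  case/andP: ba => Kb ba; rewrite ffunE; case: ifP => [/andP[_ tb]|]; rewrite ?mulr0 //.
  have [-> |cb] := eqVneq (c (mu a) b) 0; first by rewrite mul0r.
  rewrite IHn ?mulr0 //; apply: leq_trans (_ : w b < w a)%N _ => //.
  by rewrite -(w_mu Ka) c_lt ?K_mu ?t_mu ?muK.
rewrite addr0 ffunE /= Ka ta => /eqP.
by rewrite mulf_eq0 -[X in c _ X]muK // (negbTE (c_mu _ _)) ?K_mu ?t_mu // => /eqP.
Qed.

(** Invertibility of [T] yields [u] on [bot] whose differential agrees with [f] off [bot]. The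
    remainder is a cocycle living on [bot], so [T] kills it and it vanishes. *)
Lemma matching_exact : exact K.
Proof.
move=> f fK df.
have kT : lker (linfun TL) == 0%VS.
  apply/lker0P => g h; rewrite !lfunE /= => e; apply/eqP; rewrite -subr_eq0.
  by apply/eqP/T_inj; rewrite -[T _]/(TL _) linearB /= e subrr.
pose u := (linfun TL)^-1%VF [ffun a => if bot a then f (mu a) else 0].
have Tu : T u = [ffun a => if bot a then f (mu a) else 0].
  by rewrite -[T u]/(TL u) -lfunE lker0_lfunVK.
exists (cut bot u); apply/eqP; rewrite -subr_eq0; apply/eqP/T_inj.
have e0 a : ~~ bot a -> (f - d K (cut bot u)) a = 0.
  rewrite ffunB /= negb_and negbK; have [Ka /= ta|Ka _] := boolP (K a); last first.
    by rewrite (supp0 fK Ka) (supp0 (kapp_restr_supp _ _) Ka) subr0.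
  have := congr1 (fun g : {ffun I -> R^o} => g (mu a)) Tu.
  by rewrite /= TE [RHS]ffunE /= K_mu // t_mu // ta /= muK // => ->; rewrite subrr.
apply/ffunP => a; rewrite [RHS]ffunE TE; case: ifPn => [ba|/e0 //].
rewrite cut_id; last by apply/suppP => b; apply: contraNT => /e0 ->.
by rewrite linearB /= df sK subr0 ffunE.
Qed.

End Matching.

(* The isomorphism is the connecting map, induced by the differential of [K]. *)
Lemma betti_shift K (U : pred I) n : graded K -> square_zero K -> exact K ->
    (forall i, U i -> K i) ->
    (forall i j, U j -> K i -> c i j != 0 -> U i) ->
  betti [pred i | K i && ~~ U i] n = betti U n.+1.
Proof.
move=> gK sK eK UK Uup; set L := [pred i | _].
have LK i : L i -> K i by case/andP.
have gL : graded L by move=> i j /LK Ki /LK; apply: gK.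
have gU : graded U by move=> i j /UK Ki /UK; apply: gK.
(* [U] is closed under the differential, hence spans a subcomplex. *)
have dU f : f \in supp R U -> d K f = d U f.
  move=> fU; apply/ffunP => i; rewrite !kappE; case: ifP => Ki; last first.
    by case: ifP => // /UK; rewrite Ki.
  rewrite (bigID U) /= [X in _ + X]big1 ?addr0; last first.
    by move=> j /andP[_ /(supp0 fU) ->]; rewrite mulr0.
  rewrite (eq_bigl U) => [|j]; last by case: (boolP (U j)) => [/UK|];
    rewrite ?andbT ?andbF // => ->.
  case: ifPn => // Ui; apply: big1 => j Uj.
  by have [->|/(Uup _ _ Uj Ki)] := eqVneq (c i j) 0; rewrite ?mul0r // (negbTE Ui).
(* Dually, [L] spans the quotient: its differential is that of [K] followed by the projection. *)
have dL f : cut L (d K f) = d L f.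
  apply/ffunP => i; rewrite ffunE !kappE; case: ifP => // /andP[Ki Ui].
  rewrite Ki (bigID U) /= big1 ?add0r // => j /andP[_ Uj].
  by have [->|/(Uup _ _ Uj Ki)] := eqVneq (c i j) 0; rewrite ?mul0r // (negbTE Ui).
have sU : square_zero U.
  by move=> f; rewrite -(kapp_cut U f) -!dU ?sK ?cut_supp // dU ?cut_supp
    ?kapp_restr_supp.
have KLU f : f \in supp R K -> cut L f = 0 -> f \in supp R U.
  move=> /suppP fK f0; apply/suppP => i fi; have Ki := fK _ fi.
  apply: contraNT fi => Ui; have := congr1 (fun g : {ffun I -> R^o} => g i) f0.
  by rewrite !ffunE /= Ki Ui /= => ->.
have cutU f : f \in supp R U -> cut L f = 0.
  move=> fU; apply/ffunP => i; rewrite !ffunE; case: ifP => // /andP[_].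
  exact: supp0.
have cutK f : f \in supp R K -> f = cut L f + cut U f.
  move=> fK; apply/ffunP => i; rewrite !ffunE /=.
  case: (boolP (U i)) => [/UK ->|Ui]; rewrite /= ?add0r ?addr0 ?andbT //.
  by case: ifPn => // /(supp0 fK).
have sL : square_zero L.
  move=> f; have e : cut L (d K (d K f)) = 0 by rewrite sK linear0.
  rewrite -(dL f) -[LHS]dL -[RHS]e [in RHS](cutK _ (kapp_restr_supp K f)).
  by rewrite !linearD /= [X in _ + X]cutU ?addr0 // (dU _ (cut_supp _ _))
    kapp_restr_supp.
have LKsupp f : f \in supp R L -> f \in supp R K.
  by move=> /suppP fL; apply/suppP => i /fL /LK.
have dLU f : d L f = 0 -> d K f \in supp R U.
  by move=> Lf; apply: KLU; rewrite ?kapp_restr_supp ?dL.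
apply: (@dim_quasi_iso _ _ _ _ _ _ _ (linfun (d K))); first exact: cobounds_cocycles.
- exact: cobounds_cocycles.
- apply/subvP => _ /memv_imgP[f /cocyclesP[fn Lf] ->]; rewrite lfunE /=.
  have dfU := dLU f Lf; apply/cocyclesP; split; last by rewrite -dU ?sK.
  move=> i dfi; rewrite (suppP _ _ dfU) //=.
  suff /andP[] : K i && (deg i == n.+1) by [].
  apply: kapp_graded dfi => // j /fn /andP[/LK -> /eqP ->].
  by rewrite eqxx.
- move=> f /cocyclesP[fn Lf]; rewrite lfunE /=.
  have fL : f \in supp R L by apply/suppP => i /fn /andP[].
  apply/coboundsP/coboundsP => [[g gn e]|[w wn e]].
    have gU' : g \in supp R U by apply/suppP => i /gn /andP[].
    (* Injectivity: when [d K f = d K g] with [g] on [U], the cocycle [f - g] is some [d K w], and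
       the [L] part of [w] cobounds [f]. *)
    have : f - g \in cocycles K n.
      apply/cocyclesP; split; last by rewrite linearB /= e dU ?subrr.
      move=> i; rewrite ffunB => fgi.
      have [f0|/fn/andP[/LK -> ->]//] := eqVneq (f i) 0.
      have /gn/andP[/UK ->] : g i != 0 by apply: contraNneq fgi => ->; rewrite f0 subr0.
      by rewrite eqSS.
    move=> /(exact_graded gK eK) /coboundsP[w wn fgw].
    exists (cut L w).
      move=> i; rewrite ffunE; case: ifP => Li; rewrite ?eqxx //.
      by move/wn => /andP[_ ->].
    by rewrite kapp_cut -dL -fgw linearB /= cut_id // cutU ?subr0.
  have wL : w \in supp R L by apply/suppP => i /wn /andP[].
  (* Applying [d K] to [d K w = cut L (d K w) + cut U (d K w)], whose first summand is [f], gives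
     [0] on the left. *)
  exists (- cut U (d K w)).
    move=> i; rewrite ffunN cutE oppr_eq0; case: ifP; rewrite ?eqxx // => Ui dwi.
    rewrite eqSS; suff /andP[] : K i && (deg i == n) by [].
    by apply: kapp_graded dwi => // j /wn /andP[/LK ->].
  rewrite linearN /= -dU ?cut_supp //.
  have -> : cut U (d K w) = d K w - cut L (d K w).
    by rewrite [X in X - _](cutK _ (kapp_restr_supp K w)) addrC addKr.
  by rewrite linearB /= sK sub0r opprK dL -e.
move=> z /cocyclesP[zn Uz].
have zU : z \in supp R U by apply/suppP => i /zn /andP[].
have /(exact_graded gK eK) /coboundsP[w wn zw] : z \in cocycles K n.+1.
  by apply/cocyclesP; split; [move=> i /zn /andP[/UK -> ->] | rewrite dU].
have wK : w \in supp R K by apply/suppP => i /wn /andP[].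
(* Surjectivity: [z = d K w], so [cut L w] is sent to [z] up to the coboundary of [cut U w]. *)
exists (cut L w).
  apply/cocyclesP; split.
    move=> i; rewrite ffunE; case: ifP => Li; rewrite ?eqxx // => /wn.
    by rewrite eqSS => /andP[_ ->].
  by rewrite kapp_cut -dL -zw cutU.
apply/coboundsP; exists (cut U w).
  move=> i; rewrite ffunE; case: ifP => Ui; rewrite ?eqxx //.
  by move/wn => /andP[_ ->].
rewrite lfunE /= zw [in d K w](cutK w wK) linearD /= addrAC subrr add0r.
by rewrite dU ?cut_supp.
Qed.

End Betti.

(** * Invariance of Betti numbers under relabelling of cells *)

Section Transport.
Variables (R : fieldType) (I J : finType) (cI : I -> I -> R) (cJ : J -> J -> R).
Variables (K : pred I) (L : pred J) (phi : J -> I) (psi : I -> J).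
Hypothesis phiK : forall j, L j -> K (phi j) /\ psi (phi j) = j.
Hypothesis psiK : forall i, K i -> L (psi i) /\ phi (psi i) = i.
Hypothesis cE : forall j j', L j -> L j' -> cI (phi j) (phi j') = cJ j j'.

Definition pull (f : {ffun I -> R^o}) : {ffun J -> R^o} :=
  [ffun j => if L j then f (phi j) else 0].

Fact pull_linear : linear pull.
Proof.
move=> a f g; apply/ffunP => j; rewrite !ffunE.
by case: (L j) => //; rewrite scaler0 addr0.
Qed.

HB.instance Definition _ := GRing.isSemilinear.Build R {ffun I -> R^o} _ _
  pull (GRing.semilinear_linear pull_linear).

Lemma pull_kapp f : pull (kapp (restr K cI) f) = kapp (restr L cJ) (pull f).
Proof.
apply/ffunP => j; rewrite [LHS]ffunE !kappE; case: ifP => // Lj.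
rewrite (phiK Lj).1 (reindex_onto phi psi) /=; last by move=> i /psiK[].
apply: eq_big => [j'|j'].
  by apply/andP/idP => [[/psiK[+ _] /eqP e]|/phiK[-> ->]//]; rewrite e.
by move=> /andP[/psiK[+ _] /eqP e]; rewrite e => Lj'; rewrite ffunE Lj' cE.
Qed.

End Transport.

Lemma pullK (R : fieldType) (I J : finType) (K : pred I) (L : pred J)
    (phi : J -> I) (psi : I -> J) (f : {ffun I -> R^o}) :
    (forall i, K i -> L (psi i) /\ phi (psi i) = i) -> f \in supp R K ->
  pull K psi (pull L phi f) = f.
Proof.
move=> psiK fK; apply/ffunP => i; rewrite !ffunE.
by case: ifPn => [/psiK[-> ->]//|/(supp0 fK)].
Qed.

Lemma betti_bij (R : fieldType) (I J : finType) (degI : I -> nat) (degJ : J -> nat)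
    (cI : I -> I -> R) (cJ : J -> J -> R) (K : pred I) (L : pred J)
    (phi : J -> I) (psi : I -> J) n :
    graded degI cI K -> square_zero cI K ->
    (forall j, L j -> K (phi j) /\ psi (phi j) = j) ->
    (forall i, K i -> L (psi i) /\ phi (psi i) = i) ->
    (forall j, L j -> degI (phi j) = degJ j) ->
    (forall j j', L j -> L j' -> cI (phi j) (phi j') = cJ j j') ->
  betti degI cI K n = betti degJ cJ L n.
Proof.
move=> gK sK phiK psiK dE cE.
have cE' i i' : K i -> K i' -> cJ (psi i) (psi i') = cI i i'.
  by move=> /psiK[Li e] /psiK[Li' e']; rewrite -cE // e e'.
have suppn (D : nat -> nat) (f : {ffun I -> R^o}) :
    (forall i, f i != 0 -> K i && (D (degI i) == n)) ->
    (forall j, pull L phi f j != 0 -> L j && (D (degJ j) == n)).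
  move=> fn j; rewrite ffunE; case: ifP; rewrite ?eqxx // => Lj /fn /andP[_].
  by rewrite dE.
have suppn' (D : nat -> nat) (f : {ffun J -> R^o}) :
    (forall j, f j != 0 -> L j && (D (degJ j) == n)) ->
    (forall i, pull K psi f i != 0 -> K i && (D (degI i) == n)).
  move=> fn i; rewrite ffunE; case: ifP; rewrite ?eqxx // => Ki /fn /andP[Lj].
  by rewrite -dE // (psiK i Ki).2.
have toS (I0 : finType) (K0 P : pred I0) (f : {ffun I0 -> R^o}) :
  (forall i, f i != 0 -> K0 i && P i) -> f \in supp R K0.
  by move=> fK; apply/suppP => i /fK /andP[].
have gL : graded degJ cJ L.
  move=> j j' Lj Lj'; rewrite -cE // -!dE //.
  by apply: gK; [case: (phiK j Lj) | case: (phiK j' Lj')].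
have sL : square_zero cJ L.
  move=> f; have := congr1 (pull L phi) (sK (pull K psi f)).
  rewrite !(pull_kapp phiK psiK cE) linear0 => <-; congr (kapp _ _).
  rewrite -[LHS]kapp_cut; congr (kapp _ _); apply/ffunP => j; rewrite !ffunE.
  by case: ifP => // /phiK[-> ->].
apply: (@dim_quasi_iso _ _ _ _ _ _ _ (linfun (pull L phi))).
- exact: cobounds_cocycles.
- exact: cobounds_cocycles.
- apply/subvP => _ /memv_imgP[f /cocyclesP[fn df] ->]; rewrite lfunE /=.
  apply/cocyclesP; split; first exact: (suppn id).
  by rewrite -(pull_kapp phiK psiK cE) df linear0.
- move=> f /cocyclesP[fn _]; rewrite lfunE /=.
  apply/coboundsP/coboundsP => [[g gn e]|[g gn ->]].
    exists (pull K psi g); first exact: (suppn' succn).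
    rewrite -(pull_kapp psiK phiK cE') -e pullK //; exact: toS fn.
  exists (pull L phi g); first exact: (suppn succn).
  exact: (pull_kapp phiK psiK cE).
move=> g /cocyclesP[gn dg]; exists (pull K psi g).
  apply/cocyclesP; split; first exact: (suppn' id).
  by rewrite -(pull_kapp psiK phiK cE') dg linear0.
by rewrite lfunE /= pullK ?subrr ?mem0v //; apply: toS gn.
Qed.

(** * The Kunneth formula *)

(** Expanding in a basis [b] of the image and exchanging sums turns the trace into the sum over [k]
    of the [k]-th coordinate of [p b_k = b_k], which is the rank. *)
Lemma idem_trace (R : fieldType) (I : finType)
    (p : {linear {ffun I -> R^o} -> {ffun I -> R^o}}) :
    (forall f, p (p f) = p f) ->
  (\dim (limg (linfun p)))%:R = \sum_i p [ffun j => (j == i)%:R] i.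
Proof.
move=> pp; pose V := limg (linfun p).
have pV f : p f \in V by rewrite -[p f]lfunE memv_img ?memvf.
have pE v : v \in V -> p v = v.
  by case/memv_imgP => u _ ->; rewrite lfunE /= pp.
pose b := vbasis V.
under eq_bigr => i _ do rewrite {1}(coord_vbasis (pV [ffun j => (j == i)%:R]))
  sum_ffunE.
rewrite exchange_big /=.
transitivity (\sum_(k < \dim V) (1 : R)); first by rewrite sumr_const card_ord.
apply: eq_bigr => k _.
have bV : b`_k \in V by rewrite vbasis_mem ?memt_nth.
transitivity (coord b k (p b`_k)).
  by rewrite pE // coord_free ?eqxx // (basis_free (vbasisP V)).
have {1}-> : b`_k = \sum_i b`_k i *: [ffun j => (j == i)%:R : R^o].
  apply/ffunP => j; rewrite sum_ffunE (bigD1 j) //= big1 ?addr0.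
    by rewrite !ffunE eqxx /GRing.scale /= mulr1.
  by move=> i /negbTE ij; rewrite !ffunE eq_sym ij /GRing.scale /= mulr0.
rewrite !linear_sum /=; apply: eq_bigr => i _.
by rewrite !linearZ /= !ffunE /GRing.scale /= mulrC.
Qed.

(** * Operators on functions as matrices *)

Section Matrices.
Variables (R : fieldType) (I : finType).
Implicit Types (A B : 'M[R]_#|I|) (f : {ffun I -> R^o}).

Definition kmx A (i j : I) := A (enum_rank i) (enum_rank j).
Definition mxk (k : I -> I -> R) : 'M[R]_#|I| :=
  \matrix_(i, j) k (enum_val i) (enum_val j).
Definition mxapp A f := kapp (kmx A) f.

Lemma kmxP A B : (forall i j, kmx A i j = kmx B i j) -> A = B.
Proof.
move=> AB; apply/matrixP => i j.
by have := AB (enum_val i) (enum_val j); rewrite /kmx !enum_valK.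
Qed.

Lemma kmxK k i j : kmx (mxk k) i j = k i j.
Proof. by rewrite /kmx mxE !enum_rankK. Qed.

Lemma kmxM A B i j : kmx (A *m B) i j = \sum_k kmx A i k * kmx B k j.
Proof.
rewrite /kmx mxE (reindex (@enum_rank I)) //.
by exists enum_val => x _; rewrite ?enum_rankK ?enum_valK.
Qed.

Lemma mxappM A B f : mxapp (A *m B) f = mxapp A (mxapp B f).
Proof.
apply/ffunP => i; rewrite !ffunE.
under [RHS]eq_bigr do rewrite ffunE big_distrr.
rewrite exchange_big /=; apply: eq_bigr => j _; rewrite kmxM big_distrl /=.
by apply: eq_bigr => k _; rewrite mulrA.
Qed.

Lemma mxappD A B f : mxapp (A + B) f = mxapp A f + mxapp B f.
Proof.
apply/ffunP => i; rewrite !ffunE -big_split /=; apply: eq_bigr => j _.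
by rewrite /kmx mxE mulrDl.
Qed.

Lemma mxapp_mxk k f : mxapp (mxk k) f = kapp k f.
Proof. by apply/ffunP => i; rewrite !ffunE; apply: eq_bigr => j _; rewrite kmxK. Qed.

Lemma mxapp_delta A i j : mxapp A [ffun k => (k == j)%:R] i = kmx A i j.
Proof.
rewrite ffunE (bigD1 j) //= ffunE eqxx mulr1 big1 ?addr0 // => k /negbTE kj.
by rewrite ffunE kj mulr0.
Qed.

Lemma mxapp_inj A B : mxapp A =1 mxapp B -> A = B.
Proof. by move=> AB; apply: kmxP => i j; rewrite -!mxapp_delta AB. Qed.

(** The projection onto functions supported on [K], which serves as the identity of the complex
    spanned by [K]. *)
Definition unit_mx (K : pred I) : 'M[R]_#|I| :=
  mxk (fun i j => if K i && (i == j) then 1 else 0).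

Lemma mxapp_unit K f : mxapp (unit_mx K) f = cut K f.
Proof.
rewrite mxapp_mxk; apply/ffunP => i; rewrite !ffunE (bigD1 i) //= big1 => [|j ij].
  by rewrite addr0 eqxx andbT; case: ifP; rewrite ?mul1r ?mul0r.
by rewrite eq_sym (negbTE ij) andbF mul0r.
Qed.

End Matrices.

(** * Operators that shift degrees by a constant *)

Section Homogeneous.
Variables (R : fieldType) (I : finType) (deg : I -> nat) (K : pred I).
Implicit Types A B : 'M[R]_#|I|.

(* [A] is supported on [K] and raises the degree by [a - b]. *)
Definition homog a b A :=
  forall i j, kmx A i j != 0 -> [&& K i, K j & (deg i + b == deg j + a)%N].

Lemma homogM a b a' b' A B :
  homog a b A -> homog a' b' B -> homog (a + a') (b + b') (A *m B).
Proof.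
move=> hA hB i j; rewrite kmxM => s0.
have [k] : exists k, kmx A i k * kmx B k j != 0.
  apply/existsP; apply: contraNT s0; rewrite negb_exists => /forallP s0.
  by rewrite big1 // => k _; apply/eqP; rewrite -[_ == _]negbK.
rewrite mulf_eq0 negb_or => /andP[/hA/and3P[-> _ /eqP e] /hB/and3P[_ -> /eqP e']].
by apply/eqP; lia.
Qed.

Lemma homogD a b A B : homog a b A -> homog a b B -> homog a b (A + B).
Proof.
move=> hA hB i j; rewrite /kmx mxE => s0.
have [A0|/hA//] := eqVneq (kmx A i j) 0; apply: hB.
by apply: contraNneq s0 => B0; move: A0 B0; rewrite /kmx => -> ->; rewrite addr0.
Qed.

Lemma homogN a b A : homog a b A -> homog a b (- A).
Proof. by move=> hA i j; rewrite /kmx mxE oppr_eq0 => /hA. Qed.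

Lemma homogW a b a' b' A : homog a b A -> (a + b' = a' + b)%N -> homog a' b' A.
Proof. by move=> hA e i j /hA/and3P[-> -> /eqP e']; apply/eqP; lia. Qed.

Lemma homog_unit : homog 0 0 (unit_mx R K).
Proof.
move=> i j; rewrite kmxK; case: ifP => [/andP[Ki /eqP <-] _|]; rewrite ?eqxx //.
by rewrite Ki.
Qed.

Lemma unit_mulmx a b A : homog a b A -> unit_mx R K *m A = A.
Proof.
move=> hA; apply: kmxP => i j; rewrite kmxM (bigD1 i) //= big1 => [|k ik].
  rewrite kmxK eqxx andbT addr0; case: ifPn; rewrite ?mul1r ?mul0r // => Ki.
  by apply/esym/eqP; apply: contraNT Ki => /hA/and3P[].
by rewrite kmxK eq_sym (negbTE ik) andbF mul0r.
Qed.

Lemma mulmx_unit a b A : homog a b A -> A *m unit_mx R K = A.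
Proof.
move=> hA; apply: kmxP => i j; rewrite kmxM (bigD1 j) //= big1 => [|k /negbTE ik].
  rewrite kmxK eqxx andbT addr0; case: ifPn; rewrite ?mulr1 ?mulr0 // => Ki.
  by apply/esym/eqP; apply: contraNT Ki => /hA/and3P[].
by rewrite kmxK ik andbF mulr0.
Qed.

End Homogeneous.

(** * Contraction of a complex onto its cohomology *)

Section Deformation.
Variables (R : numFieldType) (I : finType) (deg : I -> nat) (c : I -> I -> R).
Variable K : pred I.
Hypothesis gK : graded deg c K.
Hypothesis sK : square_zero c K.

Definition diff_mx : 'M[R]_#|I| := mxk (restr K c).
Local Notation D := diff_mx.

(* [h] contracts the complex onto the image of the projection [r], where the
   differential vanishes; hence [r] has the Betti numbers as traces. *)
Definition deformation (h r : 'M[R]_#|I|) :=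
  [/\ homog deg K 0 1 h, homog deg K 0 0 r, D *m r = 0, r *m D = 0 &
      r *m r = r /\ D *m h + h *m D + r = unit_mx R K].

Lemma homog_diff : homog deg K 1 0 D.
Proof.
move=> i j; rewrite kmxK /restr; case: ifP; rewrite ?eqxx // => /andP[Ki Kj].
by move/(gK Ki Kj) ->; rewrite Ki Kj addn0 addn1 eqxx.
Qed.

Lemma diff_mx2 : D *m D = 0.
Proof.
apply: mxapp_inj => f; rewrite mxappM !mxapp_mxk sK; apply/ffunP => i; rewrite !ffunE.
by rewrite big1 // => j _; rewrite /kmx mxE mul0r.
Qed.

Lemma deformation_exists : exists h r, deformation h r.
Proof.
have hD := homog_diff; have DD := diff_mx2.
pose Df := linfun (kapp (restr K c)).
(* [Df^-1] inverts [Df] on its image, so [D h0 D = D]; but [h0] need not lower degrees by one. *)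
pose h0 i j := Df^-1%VF [ffun k => (k == j)%:R] i.
have h0E f : kapp h0 f = Df^-1%VF f.
  have {2}-> : f = \sum_i f i *: [ffun j => (j == i)%:R : R^o].
    apply/ffunP => j; rewrite sum_ffunE (bigD1 j) //= big1 ?addr0.
      by rewrite !ffunE eqxx /GRing.scale /= mulr1.
    by move=> i /negbTE ij; rewrite !ffunE eq_sym ij /GRing.scale /= mulr0.
  rewrite linear_sum /=; apply/ffunP => i; rewrite sum_ffunE ffunE.
  by apply: eq_bigr => j _; rewrite linearZ ffunE /GRing.scale /= mulrC.
have Dh0D : D *m mxk h0 *m D = D.
  apply: mxapp_inj => f; rewrite !mxappM !mxapp_mxk h0E.
  have := @limg_lfunVK _ _ _ Df (Df f) (memv_img _ (memvf f)).
  by rewrite !lfunE.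
(* This keeps the part of [h0] lowering degrees by one within [K]. As [D] is homogeneous, no other
   part contributes to the entries of [D h0 D] that raise degrees by one, so [G] inherits
   [D G D = D]. *)
pose g i j := if [&& K i, K j & deg j == (deg i).+1] then h0 i j else 0.
pose G := mxk g.
have hG : homog deg K 0 1 G.
  move=> i j; rewrite kmxK /g; case: ifP; rewrite ?eqxx // => /and3P[-> -> /eqP ->] _.
  by rewrite addn1 addn0 /=.
have DGD : D *m G *m D = D.
  apply: kmxP => i j.
  have hDGD := homogM (homogM hD hG) hD.
  have [dij|dij] := boolP [&& K i, K j & (deg i == (deg j).+1)]; last first.
    have [->|/hDGD] := eqVneq (kmx (D *m G *m D) i j) 0.
      have [->//|/hD/and3P[Ki Kj]] := eqVneq (kmx D i j) 0.
      by rewrite addn0 addn1 => e; rewrite Ki Kj e in dij.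
    case/and3P => Ki Kj e; case/negP: dij; rewrite Ki Kj /=.
    by apply/eqP; move/eqP: e; lia.
  rewrite -[in RHS]Dh0D !kmxM; apply: eq_bigr => l _; rewrite !kmxM !big_distrl /=.
  apply: eq_bigr => k _; rewrite [kmx G _ _]kmxK [kmx (mxk h0) _ _]kmxK /g.
  case: ifPn => // nkl.
  have [->|/hD/and3P[Ki Kk e]] := eqVneq (kmx D i k) 0; first by rewrite !mul0r.
  have [->|/hD/and3P[Kl Kj e']] := eqVneq (kmx D l j) 0; first by rewrite !mulr0.
  case/negP: nkl; rewrite Kk Kl /=; case/and3P: dij => _ _.
  by move/eqP: e; move/eqP: e' => ? ? /eqP ?; apply/eqP; lia.
(* [G] only satisfies [D G D = D]; this correction makes [D h] and [h D]
   orthogonal idempotents. *)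
pose h := G *m D *m G - G *m D *m G *m G *m D.
(* This is [unit_mx R K - D h - h D], expanded with [D G D = D] and [D D = 0]. *)
pose r := unit_mx R K - D *m G + D *m G *m G *m D - G *m D.
have hh : homog deg K 0 1 h.
  apply: homogD; [|apply: homogN].
    by apply: homogW (homogM (homogM hG hD) hG) _.
  by apply: homogW (homogM (homogM (homogM (homogM hG hD) hG) hG) hD) _.
have hr : homog deg K 0 0 r.
  apply: homogD; last by apply/homogN/(homogW (homogM hG hD)).
  apply: homogD; last by apply: homogW (homogM (homogM (homogM hD hG) hG) hD) _.
  apply: homogD; first exact: homog_unit.
  by apply/homogN/(homogW (homogM hD hG)).
have DGDX n (X : 'M_(_, n)) : D *m (G *m (D *m X)) = D *m X.
  by rewrite !mulmxA DGD.
have DDX n (X : 'M_(_, n)) : D *m (D *m X) = 0 by rewrite mulmxA DD mul0mx.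
have DGD' : D *m (G *m D) = D by rewrite mulmxA.
have UD : unit_mx R K *m D = D := unit_mulmx hD.
have DU : D *m unit_mx R K = D := mulmx_unit hD.
have UG : unit_mx R K *m G = G := unit_mulmx hG.
have Dr : D *m r = 0.
  rewrite /r !(mulmxDr, mulmxBr, mulmxN) -!mulmxA DU !DDX DGD'.
  by rewrite subr0 addr0 subrr.
have rD : r *m D = 0.
  rewrite /r !(mulmxDl, mulmxBl, mulNmx) -!mulmxA UD DD DGD' !mulmx0.
  by rewrite subrr addr0 subr0.
exists h, r; split=> //; split.
  (* Both [r D] and [r G D] vanish, so only the unit term of the second factor survives in [r r]. *)
  have rG : r *m (G *m D) = 0.
    rewrite /r !(mulmxDl, mulmxBl, mulNmx) -!mulmxA DGD' (mulmxA (unit_mx _ _)) UG.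
    by rewrite subrK subrr.
  rewrite {2}/r !(mulmxDr, mulmxBr, mulmxN) rG (mulmx_unit hr).
  by rewrite -!mulmxA !(mulmxA r D) rD !(mul0mx, mulmx0) !subr0 addr0.
rewrite /h /r !(mulmxDr, mulmxBr, mulmxN, mulmxDl, mulmxBl, mulNmx) -!mulmxA.
rewrite !DGDX !DD !DGD' !mulmx0 subr0.
set x := D *m G; set y := D *m _; set z := G *m D.
by rewrite addrC -!addrA (addrC (unit_mx _ _)) !addrA; apply/matrixP => i j;
  rewrite !mxE; ring.
Qed.

(** On a cocycle [f] the homotopy identity reads [D h f + r f = f], so with [r D = 0] the kernel of
    [r] on cocycles is the coboundaries; with [D r = 0] its image consists of cocycles. The Betti
    number is thus the rank of the projection [r] in degree [n], which is its trace there. *)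
Lemma deformation_betti h r n : deformation h r ->
  (betti deg c K n)%:R = \sum_(i | deg i == n) kmx r i i.
Proof.
case=> hh hr Dr rD [rr dhr].
have opK f : f \in supp R K -> mxapp D (mxapp h f) + mxapp h (mxapp D f) + mxapp r f
  = f.
  by move=> fK; rewrite -!mxappM -!mxappD dhr mxapp_unit cut_id.
have opDE f : mxapp D f = kapp (restr K c) f by rewrite mxapp_mxk.
have op0 f : mxapp (0 : 'M[R]_#|I|) f = 0.
  by apply/ffunP => i; rewrite !ffunE big1 // => j _; rewrite /kmx mxE mul0r.
have op_homog a b A (f : {ffun I -> R^o}) m : homog deg K a b A ->
    (forall i, f i != 0 -> (deg i + a)%N = m) ->
    forall i, mxapp A f i != 0 -> K i && (deg i + b == m)%N.
  move=> hA fm i; rewrite ffunE => s0.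
  have [j] : exists j, kmx A i j * f j != 0.
    apply/existsP; apply: contraNT s0; rewrite negb_exists => /forallP s0.
    by rewrite big1 // => k _; apply/eqP; rewrite -[_ == _]negbK.
  rewrite mulf_eq0 negb_or => /andP[/hA/and3P[-> _ /eqP ->] /fm ->].
  by rewrite eqxx.
pose Pn := [pred i | deg i == n].
pose p f := kapp (kmx r) (cut Pn f).
have p_lin : linear p by move=> a f g; rewrite /p !linearP.
pose pL : {linear {ffun I -> R^o} -> {ffun I -> R^o}} :=
  HB.pack p (GRing.isSemilinear.Build _ _ _ _ p (GRing.semilinear_linear p_lin)).
have pn f i : p f i != 0 -> K i && (deg i == n).
  rewrite -[deg i]addn0; apply: op_homog hr _ _ => j; rewrite cutE addn0.
  by case: ifP => [/eqP|]; rewrite ?eqxx.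
have pcut (f : {ffun I -> R^o}) : (forall i, f i != 0 -> K i && (deg i == n)) ->
  p f = mxapp r f.
  move=> fn; rewrite /p cut_id //; apply/suppP => i /fn /andP[_] //.
have pp f : p (p f) = p f.
  by rewrite [LHS]pcut; [rewrite -mxappM rr | exact: pn].
have -> : betti deg c K n = \dim (limg (linfun pL)).
  transitivity (\dim (limg (linfun pL)) - \dim (0%VS : {vspace {ffun I -> R^o}}))%N;
    last by rewrite dimv0 subn0.
  apply: (@dim_quasi_iso _ _ _ _ _ _ _ (linfun pL)); first exact: cobounds_cocycles.
  - exact: sub0v.
  - exact: limgS (subvf _).
  - move=> f /cocyclesP[fn df]; rewrite lfunE memv0 /= pcut //.
    have fK : f \in supp R K by apply/suppP => i /fn /andP[].
    apply/eqP/coboundsP => [rf|[g gn ->]]; last by rewrite -opDE -mxappM rD op0.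
    exists (mxapp h f); last first.
      have Df : mxapp D f = 0 by rewrite opDE.
      rewrite -opDE -[LHS](opK _ fK) rf addr0 Df.
      by rewrite [mxapp h 0]linear0 addr0.
    move=> i; rewrite -[(deg i).+1]addn1; apply: op_homog hh _ _ => j.
    by rewrite addn0 => /fn /andP[_ /eqP].
  move=> _ /memv_imgP[f _ ->]; rewrite [linfun pL f]lfunE -[pL f]/(p f).
  exists (p f).
    apply/cocyclesP; split; first exact: pn.
    by rewrite -opDE -mxappM Dr op0.
  by rewrite [linfun pL _]lfunE -[pL _]/(p _) pp subrr mem0v.
rewrite idem_trace //= [RHS]big_mkcond; apply: eq_bigr => i _.
case: ifP => din; last first.
  rewrite /p [cut _ _](_ : _ = 0) ?linear0 ?ffunE //; apply/ffunP => j.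
  rewrite cutE !ffunE; case: ifP => //= dj; case: (eqVneq j i) => // e.
  by rewrite -e dj in din.
rewrite /p cut_id; first exact: mxapp_delta.
apply/suppP => j; rewrite ffunE; case: (eqVneq j i) => [-> _|_]; first exact: din.
by rewrite eqxx.
Qed.

End Deformation.

(** * Kronecker products of matrices *)

Section TensorMatrices.
Variables (R : fieldType) (I J : finType).
Implicit Types (A : 'M[R]_#|I|) (B : 'M[R]_#|J|).

Definition tensmx A B : 'M[R]_#|{: I * J}| :=
  mxk (fun p q : I * J => kmx A p.1 q.1 * kmx B p.2 q.2).

Lemma tensmxM A A' B B' :
  tensmx A B *m tensmx A' B' = tensmx (A *m A') (B *m B').
Proof.
apply: kmxP => p q; rewrite kmxM [RHS]kmxK !kmxM big_distrlr pair_bigA /=.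
by apply: eq_bigr => k _; rewrite !kmxK mulrACA.
Qed.

Lemma tensmxDl A A' B : tensmx (A + A') B = tensmx A B + tensmx A' B.
Proof. by apply/matrixP => p q; rewrite !mxE /kmx ?mxE mulrDl. Qed.

Lemma tensmxDr A B B' : tensmx A (B + B') = tensmx A B + tensmx A B'.
Proof. by apply/matrixP => p q; rewrite !mxE /kmx ?mxE mulrDr. Qed.

Lemma tensmxNl A B : tensmx (- A) B = - tensmx A B.
Proof. by apply/matrixP => p q; rewrite !mxE /kmx ?mxE mulNr. Qed.

Lemma tensmxNr A B : tensmx A (- B) = - tensmx A B.
Proof. by apply/matrixP => p q; rewrite !mxE /kmx ?mxE mulrN. Qed.

Lemma tensmx_unit K L :
  tensmx (unit_mx R K) (unit_mx R L) = unit_mx R (fun p : I * J => K p.1 && L p.2).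
Proof.
apply: kmxP => -[p1 p2] [q1 q2]; rewrite !kmxK xpair_eqE /=.
by case: (K p1); case: (L p2); case: eqP; case: eqP; rewrite ?(mulr1, mulr0, mul0r).
Qed.

Lemma tensmx0l B : tensmx 0 B = 0.
Proof. by apply/matrixP => p q; rewrite !mxE /kmx ?mxE mul0r. Qed.

Lemma tensmx0r A : tensmx A 0 = 0.
Proof. by apply/matrixP => p q; rewrite !mxE /kmx ?mxE mulr0. Qed.

End TensorMatrices.

Definition tens_deg (I J : finType) (degI : I -> nat) (degJ : J -> nat) (p : I * J) :=
  (degI p.1 + degJ p.2)%N.

(** The usual tensor product differential, with the Koszul sign given by the degree of the first
    factor. *)
Definition tens_inc (R : fieldType) (I J : finType) (degI : I -> nat)
    (cI : I -> I -> R) (cJ : J -> J -> R) (p q : I * J) : R :=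
  cI p.1 q.1 * (p.2 == q.2)%:R + (-1) ^+ degI p.1 * (p.1 == q.1)%:R * cJ p.2 q.2.

Definition tens_pred (I J : finType) (K : pred I) (L : pred J) : pred (I * J) :=
  fun p => K p.1 && L p.2.

(** * Betti numbers of a tensor product of complexes *)

Section Kunneth.
Variables (R : numFieldType) (I J : finType) (degI : I -> nat) (degJ : J -> nat).
Variables (cI : I -> I -> R) (cJ : J -> J -> R) (K : pred I) (L : pred J).
Hypotheses (gK : graded degI cI K) (sK : square_zero cI K).
Hypotheses (gL : graded degJ cJ L) (sL : square_zero cJ L).

Local Notation DI := (diff_mx cI K).
Local Notation DJ := (diff_mx cJ L).
Local Notation cT := (tens_inc degI cI cJ).
Local Notation dT := (tens_deg degI degJ).
Local Notation KL := (tens_pred K L).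

(** The grading involution, which expresses the Koszul sign in matrix algebra: it anticommutes with
    operators of degree 1 or -1 and commutes with those of degree 0. *)
Let S : 'M[R]_#|I| :=
  mxk (fun i j => if K i && (i == j) then (-1) ^+ degI i else 0).

Let SM a b A i j : homog degI K a b A -> kmx (S *m A) i j = (-1) ^+ degI i * kmx A i j.
Proof.
move=> hA; rewrite kmxM (bigD1 i) //= big1 => [|k ik].
  rewrite kmxK eqxx andbT addr0; case: ifPn => // Ki.
  suff -> : kmx A i j = 0 by rewrite !mulr0.
  by apply/eqP; apply: contraNT Ki => /hA/and3P[].
by rewrite kmxK eq_sym (negbTE ik) andbF mul0r.
Qed.

Let MS a b A i j : homog degI K a b A -> kmx (A *m S) i j = (-1) ^+ degI j * kmx A i j.
Proof.
move=> hA; rewrite kmxM (bigD1 j) //= big1 => [|k /negbTE ik].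
  rewrite kmxK eqxx andbT addr0 mulrC; case: ifPn => // Ki.
  suff -> : kmx A i j = 0 by rewrite !mulr0.
  by apply/eqP; apply: contraNT Ki => /hA/and3P[].
by rewrite kmxK ik andbF mulr0.
Qed.

Let homogS : homog degI K 0 0 S.
Proof.
move=> i j; rewrite kmxK; case: ifP => [/andP[Ki /eqP <-] _|]; rewrite ?eqxx //.
by rewrite Ki.
Qed.

Let SS : S *m S = unit_mx R K.
Proof.
apply: kmxP => i j; rewrite (SM i j homogS) !kmxK; case: ifP => // _.
  by rewrite -exprMn mulrNN mulr1 expr1n.
by rewrite mulr0.
Qed.

Let S_odd A : homog degI K 1 0 A \/ homog degI K 0 1 A -> A *m S = - (S *m A).
Proof.
move=> hA; apply: kmxP => i j; rewrite [RHS](_ : _ = - kmx (S *m A) i j); last first.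
  by rewrite /kmx mxE.
case: hA => hA; rewrite (SM _ _ hA) (MS _ _ hA) -mulNr.
  have [->|/hA/and3P[_ _ /eqP]] := eqVneq (kmx A i j) 0; first by rewrite !mulr0.
  by rewrite addn0 => ->; rewrite addn1 exprS mulN1r opprK.
have [->|/hA/and3P[_ _ /eqP]] := eqVneq (kmx A i j) 0; first by rewrite !mulr0.
by rewrite addn0 => <-; rewrite addn1 exprS mulN1r.
Qed.

Let S_even A : homog degI K 0 0 A -> A *m S = S *m A.
Proof.
move=> hA; apply: kmxP => i j; rewrite (SM _ _ hA) (MS _ _ hA).
have [->|/hA/and3P[_ _ /eqP]] := eqVneq (kmx A i j) 0; first by rewrite !mulr0.
by rewrite !addn0 => ->.
Qed.

Lemma diff_mx_tens :
  diff_mx cT KL = tensmx DI (unit_mx R L) + tensmx S DJ.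
Proof.
apply: kmxP => p q; rewrite kmxK [RHS](_ : _ =
  kmx (tensmx DI (unit_mx R L)) p q + kmx (tensmx S DJ) p q); last by rewrite /kmx mxE.
rewrite !kmxK /restr /tens_pred /tens_inc; case: p q => [p1 p2] [q1 q2] /=.
move: (cI _ _) (cJ _ _) ((-1) ^+ _) => x y z.
have [<-|_] := eqVneq p1 q1; have [<-|_] := eqVneq p2 q2;
  rewrite ?andbT ?andbF ?andbb ?(mulr1, mulr0, addr0, mul0r).
- by case: (K p1); case: (L p2); rewrite /= ?(mul0r, mulr0, mulr1, addr0).
- by case: (K p1); case: (L p2); case: (L q2); rewrite /= ?(mul0r, mulr0, add0r).
- by case: (K p1); case: (K q1); case: (L p2); rewrite /= ?(mul0r, mulr0, mulr1).
by case: ifP; rewrite ?addr0.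
Qed.

Lemma tens_graded : graded dT cT KL.
Proof.
move=> p q /andP[Kp Lp] /andP[Kq Lq]; rewrite /tens_inc /tens_deg.
have [e|_] := eqVneq p.2 q.2; last first.
  rewrite mulr0 add0r; have [->|] := eqVneq p.1 q.1; last by rewrite mulr0 mul0r eqxx.
  by rewrite mulf_eq0 negb_or => /andP[_ /(gL Lp Lq) ->]; rewrite addnS.
have [c0|/(gK Kp Kq)->] := eqVneq (cI p.1 q.1) 0; last by rewrite e addSn.
rewrite c0 mul0r add0r; have [->|] := eqVneq p.1 q.1; last by rewrite mulr0 mul0r eqxx.
by rewrite mulf_eq0 negb_or => /andP[_ /(gL Lp Lq) ->]; rewrite addnS.
Qed.

Let hDI := homog_diff gK.
Let hDJ := homog_diff gL.
Let UDJ : unit_mx R L *m DJ = DJ := unit_mulmx hDJ.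
Let DJU : DJ *m unit_mx R L = DJ := mulmx_unit hDJ.

Lemma tens_diff_mx2 : diff_mx cT KL *m diff_mx cT KL = 0.
Proof.
rewrite diff_mx_tens mulmxDl !mulmxDr !tensmxM !diff_mx2 // tensmx0l tensmx0r.
by rewrite UDJ DJU add0r addr0 S_odd; [rewrite tensmxNl addNr | left].
Qed.

Lemma tens_square_zero : square_zero cT KL.
Proof.
move=> f; rewrite -!mxapp_mxk -mxappM tens_diff_mx2; apply/ffunP => i; rewrite !ffunE.
by rewrite big1 // => j _; rewrite /kmx mxE mul0r.
Qed.

Lemma tensmx_homog a b a' b' (A : 'M[R]_#|I|) (B : 'M[R]_#|J|) :
     homog degI K a b A -> homog degJ L a' b' B ->
  homog dT KL (a + a') (b + b') (tensmx A B).
Proof.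
move=> hA hB p q; rewrite kmxK mulf_eq0 negb_or.
move=> /andP[/hA/and3P[K1 K2 /eqP e1] /hB/and3P[L1 L2 /eqP e2]].
by rewrite /tens_pred K1 K2 L1 L2 /tens_deg /=; apply/eqP; lia.
Qed.

(** The cross terms vanish because [D r = r D = 0] and [S] anticommutes with [h]. What remains of
    the homotopy is [(1 - r)] tensor [1] plus [r] tensor [(1 - r')], that is, [1] minus [r] tensor
    [r']. *)
Lemma deformation_tens h r h' r' :
    deformation degI cI K h r -> deformation degJ cJ L h' r' ->
  deformation dT cT KL (tensmx h (unit_mx R L) + tensmx (S *m r) h') (tensmx r r').
Proof.
case=> hh hr Dr rD [rr dhr] [hh' hr' Dr' rD' [rr' dhr']].
have Uh' : unit_mx R L *m h' = h' := unit_mulmx hh'.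
have h'U : h' *m unit_mx R L = h' := mulmx_unit hh'.
have Ur : unit_mx R K *m r = r := unit_mulmx hr.
have hUL : homog degJ L 0 0 (unit_mx R L) by exact: homog_unit.
have UU : unit_mx R L *m unit_mx R L = unit_mx R L := unit_mulmx hUL.
split.
- apply: homogD; first exact: (tensmx_homog hh hUL).
  exact: (tensmx_homog (homogM homogS hr) hh').
- exact: (tensmx_homog hr hr').
- by rewrite diff_mx_tens mulmxDl !tensmxM Dr Dr' tensmx0l tensmx0r addr0.
- by rewrite diff_mx_tens mulmxDr !tensmxM rD rD' tensmx0l tensmx0r addr0.
split; first by rewrite tensmxM rr rr'.
rewrite diff_mx_tens !(mulmxDl, mulmxDr) !tensmxM UU Uh' UDJ h'U DJU.
have DSr : DI *m (S *m r) = 0.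
  by rewrite mulmxA (S_odd (or_introl hDI)) mulNmx -mulmxA Dr mulmx0 oppr0.
have SrD : S *m r *m DI = 0 by rewrite -mulmxA rD mulmx0.
have SSr : S *m (S *m r) = r by rewrite mulmxA SS.
have SrS : S *m r *m S = r by rewrite -mulmxA (S_even hr) SSr.
rewrite DSr SrD SSr SrS !tensmx0l (S_odd (or_intror hh)) tensmxNl.
have dI : DI *m h + h *m DI = unit_mx R K - r by rewrite -dhr addrK.
have dJ : DJ *m h' + h' *m DJ = unit_mx R L - r' by rewrite -dhr' addrK.
transitivity (tensmx (DI *m h + h *m DI) (unit_mx R L)
    + tensmx r (DJ *m h' + h' *m DJ) + tensmx r r').
  by rewrite tensmxDl tensmxDr; apply/matrixP => i j; rewrite !mxE; ring.
rewrite dI dJ tensmxDl tensmxNl tensmxDr tensmxNr addrA subrK subrK.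
exact: tensmx_unit.
Qed.

(** The trace of [tensmx r r'] in degree [n] splits, by the degree of the first index, into products
    of traces. Characteristic zero turns the equality in [R] into one of natural numbers. *)
Lemma betti_tens n :
  betti dT cT KL n = (\sum_(i < n.+1) betti degI cI K i * betti degJ cJ L (n - i))%N.
Proof.
have [h [r hr]] := deformation_exists gK sK.
have [h' [r' hr']] := deformation_exists gL sL.
apply/eqP; rewrite -(eqr_nat R) natr_sum; apply/eqP.
rewrite (deformation_betti tens_graded tens_square_zero _ (deformation_tens hr hr')).
under [RHS]eq_bigr => i _.
  rewrite natrM (deformation_betti gK sK _ hr) (deformation_betti gL sL _ hr').
  rewrite big_distrlr pair_big /=; over.
rewrite (partition_big (fun p : I * J => inord (degI p.1) : 'I_n.+1) predT) //=.
apply: eq_bigr => i _; apply: eq_big => [p|p _]; last by rewrite kmxK.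
rewrite /tens_deg; have := ltn_ord i => ltin.
apply/idP/idP => [/andP[/eqP e /eqP <-]|/andP[/eqP e1 /eqP e2]].
  by rewrite inordK; [apply/andP; split; apply/eqP; lia | lia].
by rewrite e1 e2 inord_val eqxx andbT; apply/eqP; lia.
Qed.

End Kunneth.

(** * Cohomology of graphs via sets of vertices *)

(** A two-step path between members of [K] stays in [K], so restriction loses no term of the square
    of the differential. *)
Lemma square_zero_convex (R : fieldType) (I : finType) (c : I -> I -> R) (K : pred I) :
    (forall i j k, K i -> K k -> c i j != 0 -> c j k != 0 -> K j) ->
  square_zero c predT -> square_zero c K.
Proof.
move=> convK s0 f; apply/ffunP => i; rewrite [RHS]ffunE kappE; case: ifP => // Ki.
rewrite -[RHS](ffunE (fun=> 0) i).
have := congr1 (fun g : {ffun I -> R^o} => g i) (s0 (cut K f)).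
rewrite kappE /= => e; rewrite ffunE; rewrite ffunE in e; rewrite -[RHS]e.
rewrite [RHS](bigID K) /= [X in _ = _ + X]big1 ?addr0 => [|j Kj].
  apply: eq_bigr => j Kj; rewrite !kappE Kj /=; congr (_ * _).
  rewrite [LHS]big_mkcond; apply: eq_bigr => k _; rewrite cutE.
  by case: ifP; rewrite ?mulr0.
have [->|cij] := eqVneq (c i j) 0; first by rewrite mul0r.
rewrite kappE big1 ?mulr0 // => k _; rewrite cutE; case: ifP; rewrite ?mulr0 // => Kk.
have [->|cjk] := eqVneq (c j k) 0; first by rewrite mul0r.
by case/negP: Kj; apply: convK cij cjk.
Qed.

(** * The coboundary on subsets of a finite set *)

Section SetComplex.
Variables (R : realFieldType) (V : finType).
Implicit Types (S : {set V}) (u v : V).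

Definition rk v : R := (enum_rank v)%:R.

Lemma rk_inj : injective rk.
Proof. by move=> u v /eqP; rewrite eqr_nat => /eqP/ord_inj/enum_rank_inj. Qed.

(** A factor is -1 exactly when [u] precedes [v], so this is the alternating sign of the position of
    [v] in [S]. *)
Definition inc_sign v S : R := \prod_(u in S :\ v) Num.sg (rk u - rk v).

(** The coboundary of the full simplex on [V], with the empty set as a cell and cardinality as
    degree. At most one summand is nonzero. *)
Definition set_inc S S' : R := \sum_(v in S) (if S' == S :\ v then inc_sign v S else 0).

Lemma inc_sign_sqr v S : inc_sign v S * inc_sign v S = 1.
Proof.
rewrite -big_split big1 //= => u; rewrite !inE => /andP[uv _].
have : rk u - rk v != 0 by rewrite subr_eq0 (inj_eq rk_inj).
by rewrite -expr2 sqr_sg => ->.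
Qed.

Lemma inc_sign_neq0 v S : inc_sign v S != 0.
Proof.
by apply/eqP => s0; have := inc_sign_sqr v S; rewrite s0 mul0r => /esym/eqP;
  rewrite oner_eq0.
Qed.

Lemma inc_signD u v S : v \in S -> u != v ->
  inc_sign u S = Num.sg (rk v - rk u) * inc_sign u (S :\ v).
Proof.
move=> vS uv; rewrite /inc_sign (big_setD1 v) /=; last by rewrite !inE eq_sym uv.
by congr (_ * _); apply: eq_bigl => w; rewrite !inE; do 2!case: eqP.
Qed.

(** Between the two orders of deletion only the factor comparing [u] with [v] differs, and it
    changes sign. *)
Lemma inc_signC u v S : u \in S -> v \in S -> u != v ->
  inc_sign v S * inc_sign u (S :\ v) = - (inc_sign u S * inc_sign v (S :\ u)).
Proof.
move=> uS vS uv; have vu : v != u by rewrite eq_sym.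
rewrite (inc_signD uS vu) (inc_signD vS uv).
by rewrite -[rk v - rk u]opprB sgrN; ring.
Qed.

Lemma set_incE S S' v : v \in S -> S' = S :\ v -> set_inc S S' = inc_sign v S.
Proof.
move=> vS ->; rewrite /set_inc (bigD1 v) //= eqxx big1 ?addr0 // => u /andP[uS uv].
case: eqP => // /setP/(_ u); rewrite !inE eqxx uv uS //.
Qed.

Lemma set_inc_neq0 S S' : set_inc S S' != 0 -> exists2 v, v \in S & S' = S :\ v.
Proof.
rewrite /set_inc => s0; have [/exists_inP[v vS /eqP e]|] := boolP [exists v in S, S'
  == S :\ v].
  by exists v.
rewrite negb_exists_in => /forall_inP nS; case/eqP: s0; apply: big1 => v /nS.
by move/negbTE ->.
Qed.

Lemma kapp_set_inc (K : pred {set V}) f S :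
  kapp (restr K set_inc) f S =
  if K S then \sum_(v in S | K (S :\ v)) inc_sign v S * f (S :\ v) else 0.
Proof.
rewrite kappE; case: ifP => // _.
under eq_bigr => S' _ do rewrite /set_inc big_distrl /=.
rewrite (exchange_big_dep (mem S)) //= [RHS]big_mkcondr; apply: eq_bigr => v vS.
rewrite big_mkcond (bigD1 (S :\ v)) //= vS andbT eqxx big1 ?addr0 // => S' /negbTE ->.
by rewrite mul0r; case: ifP.
Qed.

Lemma set_inc_graded (K : pred {set V}) : graded (fun S => #|S|) set_inc K.
Proof.
by move=> S S' _ _ /set_inc_neq0[v vS ->]; rewrite (cardsD1 v S) vS.
Qed.

Lemma set_inc_square_zero : square_zero set_inc predT.
Proof.
move=> f; apply/ffunP => S; rewrite kapp_set_inc [RHS]ffunE /=.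
pose F u v : R := inc_sign v S * (inc_sign u (S :\ v) * f (S :\ v :\ u)).
pose P := [pred p : V * V | [&& p.1 \in S, p.2 \in S & p.2 != p.1]].
transitivity (\sum_(p | P p) F p.2 p.1).
  under eq_bigr => v vS do rewrite kapp_set_inc /= big_distrr.
  rewrite (eq_bigl (mem S)) => [|v]; last by rewrite andbT.
  rewrite pair_big_dep /=; apply: eq_bigl => -[v u] /=.
  by rewrite !inE andbT [_ && (u \in S)]andbC.
(* Exchanging the two deleted vertices shows that the sum is its own opposite; it vanishes because 2
   is nonzero in [R]. *)
have FN : \sum_(p | P p) F p.2 p.1 = - \sum_(p | P p) F p.2 p.1.
  rewrite [LHS](reindex_inj (_ : injective (fun p : V * V => (p.2, p.1)))) /=;
    last first.
    by move=> [u v] [u' v'] [-> ->].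
  rewrite -sumrN.
  apply: eq_big => [[v u]|[v u]] /=; first by rewrite andbCA [v == u]eq_sym.
  case/and3P => uS vS vu; rewrite /F !mulrA inc_signC // mulNr; congr (- (_ * f _)).
  by apply/setP => w; rewrite !inE; do 2!case: eqP.
by apply/eqP; move/eqP: FN; rewrite -addr_eq0 -mulr2n mulrn_eq0.
Qed.

End SetComplex.

(** * From antisymmetric forms to functions on vertex sets *)

Section Orientation.
Variables (R : realFieldType) (G : sgraph).

(* The sign of the Vandermonde determinant of the ranks is alternating by the
   determinant and compatible with faces by its product formula. *)
Definition orient n (x : {ffun 'I_n -> G}) : R :=
  Num.sg (\det (Vandermonde n (\row_i rk R (x i)))).

Lemma orient_perm n (x : {ffun 'I_n -> G}) (s : 'S_n) :
  orient [ffun i => x (s i)] = (-1) ^+ s * orient x.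
Proof.
rewrite /orient; have -> : Vandermonde n (\row_i rk R ([ffun j => x (s j)] i)) =
    col_perm s (Vandermonde n (\row_i rk R (x i))).
  by apply/matrixP => i j; rewrite !mxE ffunE.
rewrite col_permE det_mulmx det_perm odd_permV sgrM mulrC; congr (_ * _).
by rewrite sgrX sgrN sgr1.
Qed.

Lemma orientE n (x : {ffun 'I_n -> G}) : orient x =
  \prod_(i < n) \prod_(j < n | (i < j)%N) Num.sg (rk R (x j) - rk R (x i)).
Proof.
rewrite /orient det_Vandermonde.
rewrite (big_morph Num.sg (@sgrM R) (@sgr1 R)); apply: eq_bigr => i _.
rewrite (big_morph Num.sg (@sgrM R) (@sgr1 R)); apply: eq_bigr => j _.
by rewrite !mxE.
Qed.

Definition vset k (x : osimplex G k) : {set G} := [set val x i | i : 'I_k.+1].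

Lemma osimplex_inj k (x : osimplex G k) : injective (val x).
Proof. by case/andP: (valP x) => /injectiveP. Qed.

Lemma vset_simplex k (x : osimplex G k) : simplex (vset x).
Proof.
case/andP: (valP x) => _ cx; rewrite /simplex cx andbT.
by apply/set0Pn; exists (val x ord0); apply/imsetP; exists ord0.
Qed.

Lemma card_vset k (x : osimplex G k) : #|vset x| = k.+1.
Proof. by rewrite card_imset ?card_ord //; apply: osimplex_inj. Qed.

Lemma vset_face k l (x : osimplex G k.+1) : vset (face l x) = vset x :\ val x l.
Proof.
apply/setP => v; rewrite !inE; apply/imsetP/andP => [[i _ ->]|[vl /imsetP[i _ e]]].
  rewrite ffunE (inj_eq (@osimplex_inj _ x)) eq_sym neq_lift; split=> //.
  by apply/imsetP; exists (lift l i).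
case: (unliftP l i) => [j ij|il]; last by rewrite e il eqxx in vl.
by exists j => //; rewrite ffunE -ij.
Qed.

Lemma vset_reorder k s (x : osimplex G k) : vset (reorder s x) = vset x.
Proof.
apply/setP => v; apply/imsetP/imsetP => -[i _ ->].
  by exists (s i) => //; rewrite ffunE.
by exists (s^-1%g i) => //; rewrite ffunE permKV.
Qed.

(** The factors of the Vandermonde product without index [l] make up the face. Those with [l] make
    up [inc_sign], except that the [l] comparisons with smaller indices are reversed. *)
Lemma orient_face k (l : 'I_k.+2) (x : osimplex G k.+1) :
  orient (val x) = (-1) ^+ l * inc_sign R (val x l) (vset x) * orient (val (face l x)).
Proof.
pose e (i j : 'I_k.+2) : R := Num.sg (rk R (val x j) - rk R (val x i)).
have ltl (i j : 'I_k.+1) : (lift l i < lift l j)%N = (i < j)%N.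
  by rewrite /= /bump; lia.
rewrite !orientE (bigD1_ord l) //= (big_mkcond (fun j : 'I_k.+2 => l < j)%N).
rewrite (bigD1_ord l) //= ltnn mul1r.
have -> : \prod_(i < k.+1) \prod_(j < k.+2 | (lift l i < j)%N) e (lift l i) j =
    \prod_(i < k.+1) ((if (lift l i < l)%N then e (lift l i) l else 1) *
      \prod_(j < k.+1 | (i < j)%N) e (lift l i) (lift l j)).
  apply: eq_bigr => i _; rewrite big_mkcond (bigD1_ord l) //=; congr (_ * _).
  by rewrite [RHS]big_mkcond; apply: eq_bigr => j _; rewrite ltl.
rewrite big_split mulrA -big_split /=; congr (_ * _); last first.
  by apply: eq_bigr => i _; apply: eq_bigr => j _; rewrite !ffunE.
have -> : inc_sign R (val x l) (vset x) = \prod_(i < k.+1) e l (lift l i).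
  rewrite /inc_sign -vset_face big_imset /=; last by move=> i j _ _;
    apply: (@osimplex_inj _ (face l x)).
  by apply: eq_bigr => i _; rewrite ffunE.
have -> : (-1) ^+ l = \prod_(i < k.+1) (if (lift l i < l)%N then -1 else 1) :> R.
  have lk : (l <= k.+1)%N by rewrite -ltnS.
  transitivity (\prod_(i < l) (-1 : R)); first by rewrite prodr_const card_ord.
  rewrite -big_mkcond (big_ord_widen _ (fun=> -1) lk).
  by apply: eq_bigl => i; rewrite /= /bump; lia.
rewrite -big_split; apply: eq_bigr => i _ /=.
have -> : (l < lift l i)%N = ~~ (lift l i < l)%N.
  by rewrite /= /bump; lia.
case: (lift l i < l)%N => /=; last by rewrite mulr1 mul1r.
by rewrite mul1r mulN1r /e -sgrN opprB.
Qed.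

(** Multiplying by [orient] makes a function of the vertex set antisymmetric in the ordering. *)
Definition to_omega k (g : {ffun {set G} -> R^o}) : cochain R G k :=
  [ffun x => orient (val x) * g (vset x)].

Lemma to_omega_forms k g : @to_omega k g \in forms R G k.
Proof.
apply/formsP => s x; rewrite !ffunE vset_reorder mulrA; congr (_ * _).
exact: orient_perm.
Qed.

Definition omega k g : Omega R G k := Subvs (to_omega_forms k g).

Fact omega_linear k : linear (@omega k).
Proof.
move=> a f g; apply/val_inj/ffunP => x; rewrite /= !ffunE mulrDr.
by rewrite /GRing.scale /= mulrCA.
Qed.

HB.instance Definition _ k := GRing.isSemilinear.Build R {ffun {set G} -> R^o} _ _
  (@omega k) (GRing.semilinear_linear (@omega_linear k)).

Local Notation simp := (@simplex G).
Local Notation d := (kapp (restr simp (@set_inc R G))).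

Lemma omegaE k g x : vsval (omega k g) x = orient (val x) * g (vset x).
Proof. by rewrite [LHS]ffunE. Qed.

Lemma dext_omega k g : dext R G k (omega k g) = omega k.+1 (d g).
Proof.
rewrite lfunE; apply/val_inj/ffunP => x; rewrite [RHS]omegaE [LHS]ffunE.
rewrite kapp_set_inc vset_simplex big_distrr /= [RHS](eq_bigl (mem (vset x)));
  last first.
  move=> v /=; have [/imsetP[l _ ->]|] //= := boolP (v \in vset x).
  by rewrite -vset_face vset_simplex.
rewrite big_imset /=; last by move=> i j _ _; apply: osimplex_inj.
apply: eq_bigr => l _; rewrite omegaE vset_face (orient_face l).
(* The two sides differ by the square of this sign, which is 1. *)
set a := inc_sign _ _ _.
have aa : a * a = 1 := inc_sign_sqr R (val x l) (vset x).
move: ((-1) ^+ l) (orient _) (g _) => y z t.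
by rewrite -[LHS]mulr1 -aa; ring.
Qed.

Definition some_order k (S : {set G}) : option (osimplex G k) := [pick x | vset x == S].

(** The chosen ordering does not matter: another one changes both factors by the same sign. *)
Definition of_omega k (w : Omega R G k) : {ffun {set G} -> R^o} :=
  [ffun S => if some_order k S is Some x then orient (val x) * vsval w x else 0].

Lemma of_omega_supp k w (S : {set G}) : @of_omega k w S != 0 ->
  simp S && (#|S| == k.+1).
Proof.
rewrite ffunE /some_order; case: pickP => [x /eqP <- _|]; last by rewrite eqxx.
by rewrite vset_simplex card_vset eqxx.
Qed.

Lemma orient_sqr n (x : {ffun 'I_n -> G}) : injective x -> orient x * orient x = 1.
Proof.
move=> x_inj; rewrite orientE -big_split big1 //= => i _; rewrite -big_split big1 //=.
move=> j ij; rewrite -expr2 sqr_sg subr_eq0 (inj_eq (@rk_inj R G)) (inj_eq x_inj).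
by rewrite -val_eqE gtn_eqF.
Qed.

Lemma vset_eq_reorder k (x y : osimplex G k) :
  vset x = vset y -> exists s, y = reorder s x.
Proof.
move=> e; have f i : {j | val y i = val x j}.
  case: (pickP (fun j => val y i == val x j)) => [j /eqP ?|nj]; first by exists j.
  have : val y i \in vset x by rewrite e; apply/imsetP; exists i.
  by move=> yi; exfalso; case/imsetP: yi => j _ /eqP; rewrite nj.
have f_inj : injective (fun i => sval (f i)).
  move=> i j /(congr1 (val x)); rewrite -(svalP (f i)) -(svalP (f j)).
  exact: osimplex_inj.
exists (perm f_inj); apply/val_inj/ffunP => i; rewrite /= ffunE permE.
exact: svalP (f i).
Qed.

Lemma of_omegaK k w : omega k (of_omega w) = w.
Proof.
apply/val_inj/ffunP => x; rewrite /= !ffunE /some_order.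
case: pickP => [y /eqP/vset_eq_reorder[s xs]|/(_ x)]; last by rewrite eqxx.
have /formsP wf := subvsP w; rewrite {2}xs wf.
rewrite [orient (val x)](_ : _ = (-1) ^+ s * orient (val y)); last first.
  by rewrite {1}xs; apply: orient_perm.
rewrite -mulrA; congr (_ * _); rewrite mulrA orient_sqr ?mul1r //.
exact: osimplex_inj.
Qed.

Lemma omega_inj k (g : {ffun {set G} -> R^o}) :
  (forall S, g S != 0 -> simp S && (#|S| == k.+1)) -> omega k g = 0 -> g = 0.
Proof.
move=> gk /(congr1 val)/ffunP og; apply/ffunP => S; rewrite [RHS]ffunE.
apply/eqP/idPn => gS; have /andP[/andP[_ cS] /eqP Sk] := gk S gS.
have x0P : is_osimplex [ffun i : 'I_k.+1 => enum_val (cast_ord (esym Sk) i)].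
  apply/andP; split.
    by apply/injectiveP => i j; rewrite !ffunE => /enum_val_inj/cast_ord_inj.
  apply: cliqueS cS; apply/subsetP => _ /imsetP[i _ ->]; rewrite ffunE.
  exact: enum_valP.
pose x : osimplex G k := Sub _ x0P.
have imx : vset x = S.
  apply/eqP; rewrite eqEcard card_vset Sk leqnn andbT.
  by apply/subsetP => _ /imsetP[i _ ->]; rewrite ffunE; apply: enum_valP.
have := og x; rewrite /= !ffunE imx => /(congr1 ( *%R (orient (val x)))).
rewrite mulr0 mulrA orient_sqr; last exact: osimplex_inj.
by rewrite mul1r => /eqP; apply/negP.
Qed.

Lemma simplex_square_zero : square_zero (@set_inc R G) simp.
Proof.
apply: square_zero_convex; last exact: set_inc_square_zero.
move=> S S' S'' /andP[_ cS] /andP[S0 _] /set_inc_neq0[v _ ->].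
move=> /set_inc_neq0[u _ e]; apply/andP; split.
  by apply: contraNneq S0 => S'0; rewrite e S'0 set0D.
by apply: cliqueS cS; apply: subsetDl.
Qed.

(** The map [omega] commutes with the differentials and is inverted by [of_omega] on functions on
    simplices of a fixed size. The index becomes [k.+1] because sets are graded by cardinality. *)
Lemma betti_cohomology k :
  \dim {:cohomology R G k} = betti (fun S : {set G} => #|S|) (@set_inc R G) simp k.+1.
Proof.
rewrite dim_cohomology; apply/esym.
have gr : graded (fun S : {set G} => #|S|) (@set_inc R G) simp by apply: set_inc_graded.
have bk : (boundaries R G k <= lker (dext R G k))%VS.
  case: k => [|k]; first exact: sub0v.
  by apply/subvP => _ /memv_imgP[w _ ->]; rewrite memv_ker dext_dext.
apply: (@dim_quasi_iso _ _ _ _ _ _ _ (linfun (omega k))) => //.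
- exact: cobounds_cocycles gr simplex_square_zero.
- apply/subvP => _ /memv_imgP[g /cocyclesP[_ dg] ->]; rewrite lfunE memv_ker.
  by rewrite dext_omega dg linear0.
- move=> g /cocyclesP[gk dg]; rewrite lfunE /=.
  apply/idP/coboundsP => [|[f fk ->]].
    case: k gk {dg bk} => [|k] gk /=.
      rewrite memv0 => /eqP/(omega_inj gk) ->; exists 0; last by rewrite linear0.
      by move=> S; rewrite ffunE eqxx.
    case/memv_imgP => w _; rewrite -(of_omegaK w) dext_omega => e.
    have wk (S : {set G}) : of_omega w S != 0 -> simp S && (#|S|.+1 == k.+2).
      by rewrite eqSS; apply: of_omega_supp.
    exists (of_omega w) => //; apply/eqP; rewrite -subr_eq0; apply/eqP.
    apply: (@omega_inj k.+1); last by rewrite linearB /= e subrr.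
    move=> S; rewrite ffunB => gS; have [g0|/gk//] := eqVneq (g S) 0.
    apply: (kapp_graded gr wk).
    by apply: contraNneq gS => ->; rewrite g0 subr0.
  (* For [k = 0] the primitive [f] could only live on the empty set, which is not a simplex; this
     agrees with [boundaries] being zero. *)
  case: k {gk dg g bk} fk => [|k] fk.
    have -> : f = 0.
      apply/ffunP => S; rewrite [RHS]ffunE; apply/eqP/idPn => /fk/andP[/andP[S0 _]].
      by rewrite eqSS cards_eq0 (negbTE S0).
    by rewrite !linear0 mem0v.
  by rewrite /= -dext_omega memv_img ?memvf.
move=> w; rewrite memv_ker => /eqP dw; exists (of_omega w).
  apply/cocyclesP; split; first exact: of_omega_supp.
  apply: (@omega_inj k.+1); last by rewrite -dext_omega of_omegaK.
  move=> S; apply: (kapp_graded gr) => S'; rewrite eqSS; exact: of_omega_supp.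
by rewrite lfunE /= of_omegaK subrr mem0v.
Qed.

End Orientation.

(** * The product graph *)

Definition toggle (X : finType) (x : X) (S : {set X}) :=
  if x \in S then S :\ x else x |: S.

Lemma toggleK (X : finType) (x : X) : involutive (toggle x).
Proof.
move=> S; rewrite /toggle; have [xS|xS] := boolP (x \in S).
  by rewrite !inE eqxx setD1K.
by rewrite !inE eqxx setU1K.
Qed.

Lemma in_toggle (X : finType) (x : X) (S : {set X}) :
  (x \in toggle x S) = (x \notin S).
Proof. by rewrite /toggle; case: ifP; rewrite !inE eqxx. Qed.

(** * Matchings that toggle one element of a set *)

Section Toggle.
Variables (R : fieldType) (I B X : finType) (c : I -> I -> R).
Variables (base : I -> B) (part : I -> {set X}) (upd : I -> {set X} -> I).
Variables (wt : B -> nat) (o : B -> option X) (K : pred I).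
Hypothesis base_upd : forall a S, base (upd a S) = base a.
Hypothesis part_upd : forall a S, part (upd a S) = S.
Hypothesis upd_part : forall a, upd a (part a) = a.
Hypothesis upd_upd : forall a S S', upd (upd a S) S' = upd a S'.
Hypothesis c_del : forall a x, x \in part a -> c a (upd a (part a :\ x)) != 0.
Hypothesis c_cases : forall a b, c a b != 0 ->
  (exists2 x, x \in part a & b = upd a (part a :\ x)) \/ (wt (base b) < wt (base a))%N.
Hypothesis sK : square_zero c K.
Hypothesis oK : forall a, K a ->
  exists2 x, o (base a) = Some x & K (upd a (toggle x (part a))).

(** The toggled element depends only on [base a], so toggling is an involution. A nonzero entry from
    a set with [x] to one without it either deletes [x], giving the matched partner, or lowers the
    weight of the base. *)
Lemma toggle_exact : exact c K.
Proof.
pose t a := if o (base a) is Some x then x \in part a else false.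
pose mu a := if o (base a) is Some x then upd a (toggle x (part a)) else a.
apply: (@matching_exact _ _ _ K t mu (wt \o base)) => //.
- move=> a /oK[x ox _]; rewrite /mu ox base_upd ox part_upd toggleK upd_upd.
  exact: upd_part.
- by move=> a /oK[x ox]; rewrite /mu ox.
- by move=> a /oK[x ox _]; rewrite /t /mu ox base_upd ox part_upd in_toggle.
- by move=> a /oK[x ox _]; rewrite /= /mu ox base_upd.
- move=> a /oK[x ox _]; rewrite /t /mu ox => xa.
  by rewrite {1}/toggle xa c_del.
move=> a b /oK[x ox _] Kb; rewrite {1}/t /mu ox => xa tb /c_cases[[y ya be]|//].
rewrite be /t base_upd ox part_upd !inE negb_and xa orbF negbK in tb.
by rewrite be /toggle xa (eqP tb) eqxx.
Qed.

End Toggle.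

(** * Triples of vertex sets linking product cells to chains *)

Section Product.
Variables (R : realFieldType) (G H : sgraph).
Local Notation X := (gprod G H).
Local Notation triple := (({set G} * {set H}) * {set X})%type.

Definition cell_deg := tens_deg (fun S : {set G} => #|S|) (fun T : {set H} => #|T|).
Definition cell_inc : {set G} * {set H} -> {set G} * {set H} -> R :=
  tens_inc (fun S : {set G} => #|S|) (@set_inc R G) (@set_inc R H).
Definition triple_deg := tens_deg cell_deg (fun Z : {set X} => #|Z|).
(** Built by [tens_inc] twice, so that the square-zero property on all triples follows from that on
    subsets. *)
Definition triple_inc : triple -> triple -> R := tens_inc cell_deg cell_inc (@set_inc
  R X).

Lemma set_inc_id (V : finType) (S : {set V}) : set_inc R S S = 0.
Proof.
apply/eqP/idPn => /set_inc_neq0[v vS /setP/(_ v)].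
by rewrite !inE eqxx vS.
Qed.

Lemma triple_incE a b : triple_inc a b =
  (set_inc R a.1.1 b.1.1 * (a.1.2 == b.1.2)%:R +
   (-1) ^+ #|a.1.1| * (a.1.1 == b.1.1)%:R * set_inc R a.1.2 b.1.2) * (a.2 == b.2)%:R +
  (-1) ^+ (#|a.1.1| + #|a.1.2|) * (a.1 == b.1)%:R * set_inc R a.2 b.2.
Proof. by []. Qed.

Lemma triple_inc_cases a b : triple_inc a b != 0 ->
  [\/ exists2 v, v \in a.1.1 & b = ((a.1.1 :\ v, a.1.2), a.2),
      exists2 w, w \in a.1.2 & b = ((a.1.1, a.1.2 :\ w), a.2) |
      exists2 p, p \in a.2 & b = (a.1, a.2 :\ p)].
Proof.
case: a b => [[S T] Z] [[S' T'] Z']; rewrite triple_incE xpair_eqE /=.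
have [<-|nS] := eqVneq S S'; have [<-|nT] := eqVneq T T';
  have [<-|nZ] := eqVneq Z Z';
  rewrite ?set_inc_id /= ?(mulr1, mulr0, mul0r, addr0, add0r) ?eqxx //.
- by rewrite mulf_eq0 negb_or => /andP[_ /set_inc_neq0[p pZ ->]]; constructor 3;
  exists p.
- by rewrite mulf_eq0 negb_or => /andP[_ /set_inc_neq0[w wT ->]]; constructor 2;
  exists w.
by move=> /set_inc_neq0[v vS ->]; constructor 1; exists v.
Qed.

Lemma signr_neq0 n : (-1) ^+ n != 0 :> R.
Proof. by rewrite expf_neq0 // oppr_eq0 oner_eq0. Qed.

Lemma triple_inc_del_left (S : {set G}) (T : {set H}) (Z : {set X}) v :
  v \in S -> triple_inc ((S, T), Z) ((S :\ v, T), Z) != 0.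
Proof.
move=> vS; rewrite triple_incE /= !eqxx !set_inc_id !mulr0 !addr0 !mulr1.
by rewrite (set_incE R vS erefl) inc_sign_neq0.
Qed.

Lemma triple_inc_del_right (S : {set G}) (T : {set H}) (Z : {set X}) w :
  w \in T -> triple_inc ((S, T), Z) ((S, T :\ w), Z) != 0.
Proof.
move=> wT; rewrite triple_incE /= !eqxx !set_inc_id mul0r add0r !mulr0 !addr0 !mulr1.
by rewrite (set_incE R wT erefl) mulf_neq0 ?inc_sign_neq0 ?signr_neq0.
Qed.

Lemma triple_inc_del_chain (S : {set G}) (T : {set H}) (Z : {set X}) p :
  p \in Z -> triple_inc ((S, T), Z) ((S, T), Z :\ p) != 0.
Proof.
move=> pZ; rewrite triple_incE /= !eqxx !set_inc_id mul0r add0r !mulr0 mul0r add0r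
  !mulr1.
by rewrite (set_incE R pZ erefl) mulf_neq0 ?inc_sign_neq0 ?signr_neq0.
Qed.

Lemma triple_inc_graded K : graded triple_deg triple_inc K.
Proof.
move=> a b _ _; rewrite /triple_deg /tens_deg /cell_deg /tens_deg.
case/triple_inc_cases => [[v vS ->]|[v vS ->]|[v vS ->]] /=;
  by rewrite (cardsD1 v _) vS ?addnS ?addSn //; lia.
Qed.

Lemma triple_inc_square_zero : square_zero triple_inc predT.
Proof.
have gs (V : finType) : graded (fun S : {set V} => #|S|) (@set_inc R V) predT.
  exact: set_inc_graded.
have g2 : graded cell_deg cell_inc predT by exact: (tens_graded (gs G) (gs H)).
have s2 : square_zero cell_inc predT.
  exact: (tens_square_zero (gs G) (set_inc_square_zero (R := R) (V := G))
                           (gs H) (set_inc_square_zero (R := R) (V := H))).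
exact: (tens_square_zero g2 s2 (gs X) (set_inc_square_zero (R := R) (V := X))).
Qed.

Definition incident (a : triple) :=
  [&& clique a.1.1, clique a.1.2, clique a.2 &
      [forall p in a.2, (a.1.1 \subset (val p).1) && (a.1.2 \subset (val p).2)]].

Lemma incidentS (a b : triple) : a.1.1 \subset b.1.1 -> a.1.2 \subset b.1.2 ->
  a.2 \subset b.2 ->
  incident b -> incident a.
Proof.
move=> s1 s2 s3 /and4P[c1 c2 c3 /forall_inP sub]; apply/and4P.
split; [exact: cliqueS c1 | exact: cliqueS c2 | exact: cliqueS c3 |].
apply/forall_inP => p /(subsetP s3) /sub /andP[p1 p2].
by rewrite (subset_trans s1 p1) (subset_trans s2 p2).
Qed.

Lemma triple_inc_sub (a b : triple) : triple_inc a b != 0 ->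
  [/\ b.1.1 \subset a.1.1, b.1.2 \subset a.1.2 & b.2 \subset a.2].
Proof.
by case/triple_inc_cases => -[v _ ->] /=; rewrite !subsetDl !subxx.
Qed.

Lemma subset_neq0 (V : finType) (A B : {set V}) : A \subset B -> A != set0 -> B != set0.
Proof. by move=> sAB; apply: contraNneq => B0; rewrite B0 subset0 in sAB. Qed.

(** The images of a clique under [f] form a chain of sets; its smallest member is nonempty and
    contained in all the others. *)
Lemma chain_meet (V : finType) (f : X -> {set V}) (Z : {set X}) :
    (forall p q, adj p q -> (f p \subset f q) || (f q \subset f p)) ->
    (forall p, f p != set0) -> clique Z -> Z != set0 ->
  exists v, [forall p in Z, v \in f p].
Proof.
move=> fadj f0 /forall_inP cZ /set0Pn[p0 p0Z].
case: (arg_minnP (fun p => #|f p|) p0Z) => p pZ pmin.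
have /set0Pn[v vp] := f0 p; exists v; apply/forall_inP => q qZ.
have [-> //|npq] := eqVneq q p.
have /forall_inP/(_ q qZ)/implyP := cZ p pZ; rewrite eq_sym => /(_ npq)/fadj/orP[] s.
  exact: subsetP s v vp.
have /eqP -> // : f q == f p by rewrite eqEcard s pmin.
Qed.

Lemma fst_adj (p q : X) : adj p q ->
  ((val p).1 \subset (val q).1) || ((val q).1 \subset (val p).1).
Proof. by case/andP => _ /orP[]/andP[-> _]; rewrite ?orbT. Qed.

Lemma snd_adj (p q : X) : adj p q ->
  ((val p).2 \subset (val q).2) || ((val q).2 \subset (val p).2).
Proof. by case/andP => _ /orP[]/andP[_ ->]; rewrite ?orbT. Qed.

Lemma cliqueU1 (Y : sgraph) (p : Y) (Z : {set Y}) :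
  clique Z -> (forall q, q \in Z -> p != q -> adj p q) -> clique (p |: Z).
Proof.
move=> /forall_inP cZ pq; apply/forall_inP => x xZ; apply/forall_inP => y yZ.
apply/implyP => xy; case/setU1P: xZ xy => [->|xZ]; case/setU1P: yZ => [->|yZ] xy.
- by rewrite eqxx in xy.
- exact: pq.
- by rewrite adj_sym pq // eq_sym.
by move/forall_inP: (cZ x xZ) => /(_ y yZ)/implyP; apply.
Qed.

(** The acyclic families are [over_cells], [free_left] and [free_right]. The subcomplex split off is
    [all_nonempty] in the first two and [left_empty] in the third; [left_empty] is also the quotient
    of the second. *)
Definition over_cells (a : triple) := [&& incident a, a.1.1 != set0 & a.1.2 != set0].
Definition all_nonempty (a : triple) :=
  [&& incident a, a.1.1 != set0, a.1.2 != set0 & a.2 != set0].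
Definition free_left (a : triple) := [&& incident a, a.1.2 != set0 & a.2 != set0].
Definition left_empty (a : triple) := free_left a && ~~ all_nonempty a.
Definition free_right (a : triple) := [&& incident a, a.1.1 == set0 & a.2 != set0].

Lemma over_cells_square_zero : square_zero triple_inc over_cells.
Proof.
apply: square_zero_convex triple_inc_square_zero => a b d /and3P[ia _ _] /and3P[_ d1
  d2].
move=> /triple_inc_sub[s1 s2 s3] /triple_inc_sub[t1 t2 t3]; apply/and3P; split.
- exact: incidentS ia.
- exact: subset_neq0 d1.
- exact: subset_neq0 d2.
Qed.

Lemma free_left_square_zero : square_zero triple_inc free_left.
Proof.
apply: square_zero_convex triple_inc_square_zero => a b d /and3P[ia _ _] /and3P[_ d1
  d2].
move=> /triple_inc_sub[s1 s2 s3] /triple_inc_sub[t1 t2 t3]; apply/and3P; split.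
- exact: incidentS ia.
- exact: subset_neq0 d1.
- exact: subset_neq0 d2.
Qed.

Lemma free_right_square_zero : square_zero triple_inc free_right.
Proof.
apply: square_zero_convex triple_inc_square_zero => a b d /and3P[ia /eqP a0 _]
  /and3P[_ _ d2].
move=> /triple_inc_sub[s1 s2 s3] /triple_inc_sub[t1 t2 t3]; apply/and3P; split.
- exact: incidentS ia.
- by rewrite -subset0 -a0.
- exact: subset_neq0 d2.
Qed.

(** The pair [(S, T)] is a vertex of the product because [S] and [T] are nonempty cliques. Incidence
    makes it comparable to every member of [Z], so adding it keeps a clique. *)
Lemma over_cells_exact : exact triple_inc over_cells.
Proof.
pose o (ST : {set G} * {set H}) := [pick p : X | val p == ST].
apply: (@toggle_exact _ _ _ _ _ fst snd (fun a Z => (a.1, Z)) cell_deg o) => //.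
- by case.
- by move=> [[S T] Z] p; apply: triple_inc_del_chain.
- move=> a b /triple_inc_cases[[v va ->]|[v va ->]|[p pa ->]]; last by left; exists p.
    by right; rewrite /cell_deg /tens_deg /= [X in (_ < X + _)%N](cardsD1 v) va; lia.
  by right; rewrite /cell_deg /tens_deg /= [X in (_ < _ + X)%N](cardsD1 v) va; lia.
- exact: over_cells_square_zero.
move=> [[S T] Z] /and3P[/= /and4P[/= cS cT cZ /forall_inP sub] S0 T0].
have ST : simplex S && simplex T by rewrite /simplex S0 T0 cS cT.
pose p : X := Sub (S, T) ST.
exists p.
  rewrite /o; case: pickP => [q /eqP qE|/(_ p)]; last by rewrite SubK eqxx.
  by congr Some; apply: val_inj; rewrite SubK.
rewrite /over_cells /= S0 T0 !andbT; apply/and4P; split=> //=.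
  rewrite /toggle; case: ifP => _; first by apply: cliqueS cZ; apply: subsetDl.
  by apply: cliqueU1 => // q /sub /andP[s1 s2] pq; apply/andP; split=> //=;
    rewrite s1 s2.
apply/forall_inP => q; rewrite /toggle; case: ifP => _.
  by case/setD1P => _ /sub.
by case/setU1P => [->|/sub //]; rewrite SubK /= !subxx.
Qed.

(** The toggled vertex lies in the first component of every member of [Z], so incidence persists. As
    [Z] is nonempty, the new [S] lies in some simplex and is again a clique. *)
Lemma free_left_exact : exact triple_inc free_left.
Proof.
pose o (TZ : {set H} * {set X}) := [pick v : G | [forall p in TZ.2, v \in (val p).1]].
apply: (@toggle_exact _ _ _ _ _ (fun a : triple => (a.1.2, a.2)) (fun a => a.1.1)
  (fun a S => ((S, a.1.2), a.2)) (fun b => #|b.1| + #|b.2|)%N o) => //.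
- by case=> [[]].
- by move=> [[S T] Z] v; apply: triple_inc_del_left.
- move=> a b /triple_inc_cases[[v va ->]|[v va ->]|[v va ->]]; first by left; exists v.
    by right; rewrite /= [X in (_ < X + _)%N](cardsD1 v) va; lia.
  by right; rewrite /= ltn_add2l [X in (_ < X)%N](cardsD1 v) va.
- exact: free_left_square_zero.
move=> [[S T] Z] /and3P[/= /and4P[/= cS cT cZ /forall_inP sub] T0 Z0].
have [|v0 v0P] := @chain_meet _ (fun p => (val p).1) Z fst_adj _ cZ Z0.
  by move=> p; case/andP: (valP p) => /andP[].
rewrite /o /=; case: pickP => [v /forall_inP vZ|/(_ v0)]; last by rewrite v0P.
exists v => //; rewrite /free_left /= T0 Z0 !andbT.
have sv p : p \in Z -> (toggle v S \subset (val p).1) && (T \subset (val p).2).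
  move=> pZ; case/andP: (sub p pZ) => Sp ->; rewrite andbT /toggle.
  case: ifP => _; first exact: subset_trans (subsetDl _ _) Sp.
  by rewrite subUset sub1set vZ.
apply/and4P; split=> //=; last exact/forall_inP.
case/set0Pn: Z0 => p pZ; case/andP: (sv p pZ) => + _; move/cliqueS; apply.
by case/andP: (valP p) => /andP[].
Qed.

(** The mirror image of [free_left_exact], with [T] toggled while [S] stays empty. *)
Lemma free_right_exact : exact triple_inc free_right.
Proof.
pose o (TZ : {set G} * {set X}) := [pick v : H | [forall p in TZ.2, v \in (val p).2]].
apply: (@toggle_exact _ _ _ _ _ (fun a : triple => (a.1.1, a.2)) (fun a => a.1.2)
  (fun a T => ((a.1.1, T), a.2)) (fun b => #|b.1| + #|b.2|)%N o) => //.
- by case=> [[]].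
- by move=> [[S T] Z] v; apply: triple_inc_del_right.
- move=> a b /triple_inc_cases[[v va ->]|[v va ->]|[v va ->]]; last 1 first.
  + by right; rewrite /= ltn_add2l [X in (_ < X)%N](cardsD1 v) va.
  + by right; rewrite /= [X in (_ < X + _)%N](cardsD1 v) va; lia.
  by left; exists v.
- exact: free_right_square_zero.
move=> [[S T] Z] /and3P[/= /and4P[/= cS cT cZ /forall_inP sub] S0 Z0].
have [|v0 v0P] := @chain_meet _ (fun p => (val p).2) Z snd_adj _ cZ Z0.
  by move=> p; case/andP: (valP p) => _ /andP[].
rewrite /o /=; case: pickP => [v /forall_inP vZ|/(_ v0)]; last by rewrite v0P.
exists v => //; rewrite /free_right /= S0 Z0 !andbT.
have sv p : p \in Z -> (S \subset (val p).1) && (toggle v T \subset (val p).2).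
  move=> pZ; case/andP: (sub p pZ) => -> Tp; rewrite /toggle /=.
  case: ifP => _; first exact: subset_trans (subsetDl _ _) Tp.
  by rewrite subUset sub1set vZ.
apply/and4P; split=> //=; last exact/forall_inP.
case/set0Pn: Z0 => p pZ; case/andP: (sv p pZ) => _; move/cliqueS; apply.
by case/andP: (valP p) => _ /andP[].
Qed.

Lemma clique0 (Y : sgraph) : clique (set0 : {set Y}).
Proof. by apply/forall_inP => x; rewrite inE. Qed.

Local Notation cells := (tens_pred (@simplex G) (@simplex H)).
Local Notation only_cells := [pred a | over_cells a && ~~ all_nonempty a].
Local Notation only_chains := [pred a | free_right a && ~~ left_empty a].

Lemma only_cells_square_zero : square_zero triple_inc only_cells.
Proof.
apply: square_zero_convex triple_inc_square_zero => -[[S T] Z] [[S' T'] Z'] [[S''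
  T''] Z''].
move=> /andP[/and3P[/= ia S0 T0]]; rewrite /all_nonempty ia S0 T0 /= negbK => /eqP Z0.
move=> /andP[/and3P[/= _ S0' T0'] _].
move=> /triple_inc_sub[/= s1 s2 s3] /triple_inc_sub[/= t1 t2 t3];
  rewrite /= /over_cells /all_nonempty /=.
rewrite Z0 subset0 in s3; rewrite s3 /= !andbF andbT; apply/and3P; split=> /=.
- by apply: incidentS ia => //=; rewrite (eqP s3) sub0set.
- exact: subset_neq0 S0'.
- exact: subset_neq0 T0'.
Qed.

Lemma only_chains_square_zero : square_zero triple_inc only_chains.
Proof.
apply: square_zero_convex triple_inc_square_zero => -[[S T] Z] [[S' T'] Z'] [[S''
  T''] Z''].
move=> /andP[/and3P[/= ia S0 Z0]]; rewrite /left_empty /free_left /all_nonempty /= ia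
  S0 Z0 /= !andbT.
rewrite negbK => /eqP T0 /andP[/and3P[/= _ S0' Z0'] _].
move=> /triple_inc_sub[/= s1 s2 s3] /triple_inc_sub[/= t1 t2 t3];
  rewrite /= /free_right /left_empty /free_left /all_nonempty /=.
rewrite T0 subset0 in s2; rewrite (eqP S0) subset0 in s1; rewrite s2 s1 /= !andbF andbT.
rewrite (subset_neq0 t3 Z0') andbT.
by apply: incidentS ia => //=; rewrite ?(eqP s1) ?(eqP s2) ?sub0set.
Qed.

Lemma betti_cells n : betti triple_deg triple_inc only_cells n =
  betti cell_deg cell_inc cells n.
Proof.
apply: (@betti_bij _ _ _ _ _ _ _ _ _ (fun ST => (ST, set0)) fst).
- exact: triple_inc_graded.
- exact: only_cells_square_zero.
- move=> [S T] /andP[/andP[/= S0 cS] /andP[/= T0 cT]]; split=> //=.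
  rewrite /over_cells /all_nonempty /= S0 T0 eqxx /= !andbF !andbT.
  by apply/and4P; split=> //=; [exact: clique0 | apply/forall_inP => p; rewrite inE].
- move=> [[S T] Z] /andP[/and3P[/= ia S0 T0]]; rewrite /all_nonempty ia S0 T0 /= negbK.
  move=> /eqP ->; split=> //; case/and4P: ia => /= cS cT _ _.
  by rewrite /tens_pred /simplex /= S0 T0 cS cT.
- by move=> ST _; rewrite /triple_deg /tens_deg /= cards0 addn0.
by move=> ST ST' _ _; rewrite /triple_inc /tens_inc /= eqxx mulr1 set_inc_id mulr0
  addr0.
Qed.

(** With [S] and [T] empty the Koszul sign is 1 and the degree is the cardinality of [Z]. *)
Lemma betti_gprod n :
  betti triple_deg triple_inc only_chains n =
    betti (fun Z : {set X} => #|Z|) (@set_inc R X) (@simplex X) n.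
Proof.
apply: (@betti_bij _ _ _ _ _ _ _ _ _ (fun Z => ((set0, set0), Z)) snd).
- exact: triple_inc_graded.
- exact: only_chains_square_zero.
- move=> Z /andP[Z0 cZ]; split=> //=.
  rewrite /free_right /left_empty /free_left /= Z0 !eqxx /= andbF /= !andbT;
    apply/and4P; split=> //=.
  - exact: clique0.
  - exact: clique0.
  by apply/forall_inP => p _; rewrite !sub0set.
- move=> [[S T] Z] /andP[/and3P[/= ia S0 Z0]].
  rewrite /left_empty /free_left /all_nonempty /= ia S0 Z0 /= !andbT negbK => /eqP ->.
  by rewrite (eqP S0); split=> //; case/and4P: ia => _ _ cZ _; rewrite /simplex Z0.
- by move=> Z _; rewrite /triple_deg /cell_deg /tens_deg /= !cards0.
move=> Z Z' _ _; rewrite triple_incE /= !eqxx !set_inc_id mul0r mulr0 addr0 mul0r add0r.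
by rewrite !cards0 mul1r mul1r.
Qed.

(** The shifts lead from chains in degree [n] to [left_empty] in degree [n.+1], then to
    [all_nonempty] in degree [n.+2], and back down to cells in degree [n.+1]. *)
Lemma betti_product n :
  betti (fun Z : {set X} => #|Z|) (@set_inc R X) (@simplex X) n =
  betti cell_deg cell_inc cells n.+1.
Proof.
have up a b : incident a -> triple_inc a b != 0 -> all_nonempty b -> all_nonempty a.
  move=> ia /triple_inc_sub[s1 s2 s3] /and4P[_ b1 b2 b3].
  by rewrite /all_nonempty ia (subset_neq0 s1) ?(subset_neq0 s2) ?(subset_neq0 s3).
have sub1 a : all_nonempty a -> over_cells a by case/and4P => ? ? ? _; apply/and3P.
have sub2 a : all_nonempty a -> free_left a by case/and4P => ? _ ? ?; apply/and3P.
have sub3 a : left_empty a -> free_right a.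
  case/andP => /and3P[ia T0 Z0]; rewrite /all_nonempty ia T0 Z0 !andbT negbK => S0.
  by apply/and3P.
have up1 a b : all_nonempty b -> over_cells a -> triple_inc a b != 0 -> all_nonempty a.
  by move=> fb /and3P[ia _ _] /up; apply.
have up2 a b : all_nonempty b -> free_left a -> triple_inc a b != 0 -> all_nonempty a.
  by move=> fb /and3P[ia _ _] /up; apply.
have up3 a b : left_empty b -> free_right a -> triple_inc a b != 0 -> left_empty a.
  move=> /andP[/and3P[_ T0 _] _] /and3P[ia S0 Za] /triple_inc_sub[_ s2 _].
  by rewrite /left_empty /free_left /all_nonempty ia S0 Za (subset_neq0 s2 T0).
rewrite -betti_gprod -betti_cells.
have -> := betti_shift n (@triple_inc_graded free_right) free_right_square_zero
  free_right_exact sub3 up3.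
have -> := betti_shift n.+1 (@triple_inc_graded over_cells) over_cells_square_zero
  over_cells_exact sub1 up1.
exact: betti_shift n.+1 (@triple_inc_graded free_left) free_left_square_zero
  free_left_exact sub2 up2.
Qed.

End Product.

(** * Comparison of dimensions on the two sides *)

Theorem theorem9 (R : realType) (G H : sgraph) (k : nat) :
  exists phi : {linear cohomology R (gprod G H) k ->
      dsum (fun i : 'I_k.+1 =>
        tensor (cohomology R G i) (cohomology R H (k - i)%N))},
    bijective phi.
Proof.
(* The cells appear in degree [k.+2]: one unit comes from grading by cardinality, the other from the
   connecting maps. *)
apply: dim_linear_bij; rewrite dim_dsum betti_cohomology betti_product.
have gs (Y : sgraph) := @set_inc_graded R Y (@simplex Y).
have sz := @simplex_square_zero R.
rewrite /cell_deg /cell_inc (betti_tens (gs G) (sz G) (gs H) (sz H)).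
have b0 (Y : sgraph) : betti (fun S : {set Y} => #|S|) (@set_inc R Y) (@simplex Y) 0
  = 0%N.
  rewrite /betti; suff -> : cocycles (fun S : {set Y} => #|S|) (@set_inc R Y)
    (@simplex Y) 0 = 0%VS.
    by rewrite dimv0.
  apply/eqP; rewrite -subv0; apply/subvP => f /cocyclesP[f0 _]; rewrite memv0.
  apply/eqP/ffunP => S; rewrite [RHS]ffunE; apply/eqP/idPn => /f0 /andP[/andP[S0 _]].
  by rewrite cards_eq0 (negbTE S0).
(* The first and last of the [k.+3] terms contain a Betti number in cardinality 0, which is zero.
   The others, reindexed by [i.+1], account for one cardinality shift in each factor. *)
rewrite big_ord_recl big_ord_recr /= b0 mul0n add0n /bump /= subnn b0 muln0 addn0.
apply: eq_bigr => i _; rewrite dim_tensor !betti_cohomology add1n.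
by rewrite subSS subSn // -ltnS.
Qed.
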